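(* Let $M$ be a connected orientable smooth manifold of dimension $n\ge 2$ equipped with a projective structure $p$ (an equivalence class of projectively related special torsion-free affine connections). Let $\sigma=\sigma^{ab}\in\Gamma(S^2TM\otimes\mathcal E(-2))$ be a non-degenerate solution of the metricity equation $D\sigma=0$. Then $\sigma$ is normal (i.e. $\nabla L(\sigma)=0$ for the tractor connection on $S^2\mathcal T$) if and only if the corresponding pseudo-Riemannian metric $g^\sigma$ is an Einstein metric. Here, if $n=2$, ''Einstein'' is taken to mean constant Gaussian curvature.
   Context: Setting. Torsion-free affine connections are projectively equivalent if they have the same geodesics as unparametrised curves. A connection is special if it preserves some volume form on $M$; $p$ denotes an equivalence class of projectively equivalent special torsion-free connections. $\mathcal E(1)$ is a line bundle whose $(-2n-2)$nd power is $(\Lambda^nT^*M)^{\otimes 2}$, and $\mathcal E(w)$ ($w\in\mathbb R$) are its real powers (so $\mathcal E(-n-1)\cong\Lambda^nT^*M$, $M$ being oriented); each $\nabla\in p$ induces a connection on each $\mathcal E(w)$. For a bundle $\mathcal B$, $\mathcal B(w):=\mathcal B\otimes\mathcal E(w)$. Abstract indices: $\mathcal E^{(bc)}=S^2TM$, $(\mathcal E_a{}^{(bc)})_0$ is the trace-free part of $T^*M\otimes S^2TM$. Curvature. For $\nabla\in p$ with curvature $R_{ab}{}^c{}_d$ and Ricci tensor $R_{ab}=R_{ca}{}^c{}_b$, the projective Schouten tensor $P_{ab}$ is defined by $(n-1)P_{ab}=R_{ab}$ (symmetric, as $\nabla$ is special). Metricity operator. $D:\mathcal E^{(bc)}(-2)\to(\mathcal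 E_a{}^{(bc)})_0(-2)$, $D\sigma=$ trace-free part of $\nabla_a\sigma^{bc}$; it is independent of $\nabla\in p$. Non-degeneracy and $g^\sigma$. $\sigma$ is non-degenerate if it is (everywhere) non-degenerate as a bilinear form on $T^*M(1)$. With $\boldsymbol\epsilon_{a_1\cdots a_n}$ the canonical section of $\Lambda^nT^*M(n+1)$ (giving the tautological map $\Lambda^nTM\to\mathcal E(n+1)$), put $\tau^\sigma:=\sigma^{a_1b_1}\cdots\sigma^{a_nb_n}\boldsymbol\epsilon_{a_1\cdots a_n}\boldsymbol\epsilon_{b_1\cdots b_n}\in\Gamma(\mathcal E(2))$. For non-degenerate $\sigma$, $g^\sigma_{ab}$ is the pseudo-Riemannian metric inverse to $\tau^\sigma\sigma^{ab}$. Tractors. The cotractor bundle is $\mathcal T^*=J^1\mathcal E(1)$, with dual the tractor bundle $\mathcal T$. A choice of $\nabla\in p$ splits $J^1\mathcal E(1)\cong\mathcal E(1)\oplus T^*M(1)$, hence $S^2\mathcal T\cong S^2TM(-2)\oplus TM(-2)\oplus\mathcal E(-2)$, with elements written as triples $(\sigma^{bc},\mu^b,\rho)$; the projection $\Pi:S^2\mathcal T\to S^2TM(-2)$ to the first component does not depend on $\nabla$. The tractor connection on $S^2\mathcal T$, which depends only on $p$, is $$\nabla_a(\sigma^{bc},\mu^b,\rho)=\big(\nabla_a\sigma^{bc}+\delta_a^b\mu^c+\delta_a^c\mu^b,\ \nabla_a\mu^b+\delta_a^b\rho-P_{ac}\sigma^{bc},\ \nabla_a\rho-2P_{ab}\mu^b\big).$$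 Splitting operator $L$ and normality. For $\sigma\in\Gamma(S^2TM(-2))$, $L(\sigma)$ is the unique section of $S^2\mathcal T$ with $\Pi(L(\sigma))=\sigma$ such that the first two components of $\nabla L(\sigma)$ (in $T^*M\otimes S^2TM(-2)$ and $T^*M\otimes TM(-2)$) are trace-free. Explicitly $L(\sigma)=(\sigma^{bc},\mu^b,\rho)$ with $\mu^b=-\frac1{n+1}\nabla_i\sigma^{ib}$, $\rho=-\frac1n(\nabla_i\mu^i-P_{ij}\sigma^{ij})$. A solution $\sigma$ of $D\sigma=0$ is called normal if $\nabla L(\sigma)=0$. *)

(* Defs.v *)
From mathcomp Require Import all_boot all_order all_algebra.
From mathcomp Require Import all_classical all_reals all_analysis.

Set Implicit Arguments.
Unset Strict Implicit.
Unset Printing Implicit Defensive.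

Import Order.TTheory GRing.Theory Num.Theory numFieldNormedType.Exports.

Local Open Scope classical_set_scope.
Local Open Scope ring_scope.

(* Geometric objects on M are given by their components in the charts of a
   smooth atlas, together with the transformation law of the bundle they are
   sections of.  Component functions are total on R^n; only their values on
   the image of the chart are meaningful, and all conditions are restricted
   to it. *)

Section Smoothness.
Variable R : realType.

(* Used on open sets only. *)
Fixpoint Ck_on (k : nat) (V W : normedModType R) (U : set V) (f : V -> W) :
    Prop :=
  if k is k'.+1 then
    (forall x, U x -> differentiable f x) /\
    (forall v : V, Ck_on k' U (fun x => 'D_v f x))
  else forall x, U x -> {for x, continuous f}.

Definition smooth_on (V W : normedModType R) (U : set V) (f : V -> W) : Prop :=
  forall k, Ck_on k U f.

Definition partial (n : nat) (a : 'I_n) (f : 'rV[R]_n -> R) (x : 'rV[R]_n) : R :=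
  'D_('e_a) f x.

End Smoothness.

Record smooth_atlas (R : realType) (n : nat) (M : topologicalType) := SmoothAtlas {
  chart : Type;
  dom : chart -> set M;
  coord : chart -> M -> 'rV[R]_n;
  param : chart -> 'rV[R]_n -> M;
  img := fun i => coord i @` dom i;
  trans := fun i j x => coord j (param i x);
  overlap := fun i j => [set x | img i x /\ dom j (param i x)];
  dom_open : forall i, open (dom i);
  dom_cover : forall q : M, exists i, dom i q;
  img_open : forall i, open (img i);
  coordK : forall i q, dom i q -> param i (coord i q) = q;
  coord_continuous : forall i q, dom i q -> {for q, continuous (coord i)};
  param_continuous : forall i x, img i x -> {for x, continuous (param i)};
  trans_smooth : forall i j, smooth_on (overlap i j) (trans i j)
}.

Section Geometry.
Variables (R : realType) (n : nat) (M : topologicalType).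
Variable A : smooth_atlas R n M.

Implicit Types (i j : chart A) (x : 'rV[R]_n).

(* [jac i j x a b] is dy^b/dx^a for the change of coordinates y = trans i j x. *)
Definition jac i j x : 'M[R]_n :=
  \matrix_(a, b) partial a (fun y => trans i j y 0 b) x.

(* A nowhere vanishing n-form: [omega i] is the coefficient of
   dx^1 /\ ... /\ dx^n in the chart i. *)
Record volume_form (omega : chart A -> 'rV[R]_n -> R) : Prop := VolumeForm {
  volume_smooth : forall i, smooth_on (img i) (omega i);
  volume_neq0 : forall i x, img i x -> omega i x != 0;
  volume_law : forall i j x, overlap i j x ->
    omega i x = \det (jac i j x) * omega j (trans i j x)
}.

Definition orientable : Prop := exists omega, volume_form omega.

(* Affine connections are given by their Christoffel symbols:
   [G i x c a b] is Gamma^c_ab, where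
   nabla_a X^c = d_a X^c + Gamma^c_ab X^b. *)
Definition christoffels := chart A -> 'rV[R]_n -> 'I_n -> 'I_n -> 'I_n -> R.

Record affine_connection := AffineConnection {
  gamma :> christoffels;
  gamma_smooth : forall i c a b, smooth_on (img i) (fun x => gamma i x c a b);
  gamma_law : forall i j x, overlap i j x -> forall k a b,
    \sum_c \sum_d jac i j x a c * jac i j x b d * gamma j (trans i j x) k c d =
    \sum_c jac i j x c k * gamma i x c a b
    - partial a (partial b (fun y => trans i j y 0 k)) x
}.

Definition torsion_free (G : christoffels) : Prop :=
  forall i x, img i x -> forall c a b, G i x c a b = G i x c b a.

Definition christoffel_trace (G : christoffels) i x (a : 'I_n) : R :=
  \sum_d G i x d a d.

Definition special (G : christoffels) : Prop :=
  exists2 omega, volume_form omega &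
    forall i x, img i x -> forall a,
      partial a (omega i) x - christoffel_trace G i x a * omega i x = 0.

Definition open_interval (I : set R) : Prop := open I /\ is_interval I.

Definition geodesic (G : christoffels) (I : set R) (c : R -> M) : Prop :=
  (forall t, I t -> {for t, continuous c}) /\
  forall i, let I' := I `&` c @^-1` dom i in let u := coord i \o c in
    smooth_on I' u /\
    forall t, I' t -> forall k,
      derive1 (derive1 u) t 0 k
      + \sum_a \sum_b G i (u t) k a b * derive1 u t 0 a * derive1 u t 0 b = 0.

Definition reparametrisation (h : R -> R) (J I : set R) : Prop :=
  [/\ open_interval J, smooth_on J h,
      forall t, J t -> derive1 h t != 0 & h @` J = I].

Definition geodesics_included (G G' : christoffels) : Prop :=
  forall I c, open_interval I -> geodesic G I c ->
    exists J h, reparametrisation h J I /\ geodesic G' J (c \o h).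

Definition projectively_equivalent (G G' : christoffels) : Prop :=
  geodesics_included G G' /\ geodesics_included G' G.

Definition special_torsion_free (G : christoffels) : Prop :=
  torsion_free G /\ special G.

Definition projective_structure (p : set affine_connection) : Prop :=
  exists2 G0 : affine_connection, special_torsion_free G0 &
    p = [set G | special_torsion_free G /\ projectively_equivalent G0 G].

(* E(w) is trivialised in each chart by the power -w/(n+1) of
   |dx^1 /\ ... /\ dx^n|; accordingly E(1)^(-2n-2) is the square of the bundle
   of n-forms. *)
Definition weight_factor (w : R) i j x : R :=
  `|\det (jac i j x)| `^ (w / n.+1%:R).

Record S2TM (w : R) := S2TMSection {
  bivec :> chart A -> 'rV[R]_n -> 'M[R]_n;
  bivec_smooth : forall i b c, smooth_on (img i) (fun x => bivec i x b c);
  bivec_sym : forall i x, img i x -> (bivec i x)^T = bivec i x;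
  bivec_law : forall i j x, overlap i j x ->
    bivec j (trans i j x) =
    weight_factor w i j x *: ((jac i j x)^T *m bivec i x *m jac i j x)
}.

(* The weight terms come from the connection induced on E(w): it acts on
   n-forms, of weight -n-1, by - christoffel_trace. *)
Section CovariantDerivatives.
Variables (G : christoffels) (w : R).

Definition weight_term i x (a : 'I_n) : R :=
  w / n.+1%:R * christoffel_trace G i x a.

Definition nabla0 (f : chart A -> 'rV[R]_n -> R) i x (a : 'I_n) : R :=
  partial a (f i) x + weight_term i x a * f i x.

Definition nabla1 (mu : chart A -> 'rV[R]_n -> 'I_n -> R) i x (a b : 'I_n) : R :=
  partial a (fun y => mu i y b) x
  + \sum_d G i x b a d * mu i x d
  + weight_term i x a * mu i x b.

Definition nabla2 (sigma : chart A -> 'rV[R]_n -> 'M[R]_n) i x (a b c : 'I_n) : R :=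
  partial a (fun y => sigma i y b c) x
  + \sum_d G i x b a d * sigma i x d c
  + \sum_d G i x c a d * sigma i x b d
  + weight_term i x a * sigma i x b c.

End CovariantDerivatives.

(* [curvature G i x a b c d] is R_ab^c_d, where
   (nabla_a nabla_b - nabla_b nabla_a) X^c = R_ab^c_d X^d. *)
Definition curvature (G : christoffels) i x (a b c d : 'I_n) : R :=
  partial a (fun y => G i y c b d) x - partial b (fun y => G i y c a d) x
  + \sum_e (G i x c a e * G i x e b d - G i x c b e * G i x e a d).

Definition ricci (G : christoffels) i x (a b : 'I_n) : R :=
  \sum_c curvature G i x c a c b.

Definition schouten (G : christoffels) i x (a b : 'I_n) : R :=
  (n%:R - 1)^-1 * ricci G i x a b.

Definition kron (a b : 'I_n) : R := (a == b)%:R.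

(* The trace-free part of T_a^(bc). *)
Definition trace_free_part (T : 'I_n -> 'I_n -> 'I_n -> R) (a b c : 'I_n) : R :=
  T a b c - n.+1%:R^-1 * (kron a b * \sum_d T d d c + kron a c * \sum_d T d b d).

Definition metricity_op (G : christoffels) (sigma : S2TM (-2)) i x :
    'I_n -> 'I_n -> 'I_n -> R :=
  trace_free_part (nabla2 G (-2) sigma i x).

Definition metricity_solution (p : set affine_connection) (sigma : S2TM (-2)) :
    Prop :=
  forall G, p G -> forall i x, img i x -> forall a b c,
    metricity_op G sigma i x a b c = 0.

Definition nondegenerate_section (w : R) (sigma : S2TM w) : Prop :=
  forall i x, img i x -> forall u : 'rV[R]_n,
    (forall v : 'rV[R]_n, (u *m sigma i x *m v^T) 0 0 = 0) -> u = 0.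

(* The Levi-Civita symbol: the components of the canonical section of
   Lambda^n T^*M (n+1) in the trivialisations of E(w) above, up to an overall
   sign (the orientation of the chart), which cancels in [tau]. *)
Definition epsilon (a : {ffun 'I_n -> 'I_n}) : R := \det (\matrix_(k, l) kron (a k) l).

Definition tau (sigma : S2TM (-2)) i x : R :=
  \sum_(a : {ffun 'I_n -> 'I_n}) \sum_(b : {ffun 'I_n -> 'I_n})
    (\prod_k sigma i x (a k) (b k)) * epsilon a * epsilon b.

Definition metric_of (sigma : S2TM (-2)) i x : 'M[R]_n :=
  invmx (tau sigma i x *: sigma i x).

Section Metric.
Variable g : chart A -> 'rV[R]_n -> 'M[R]_n.

Definition levi_civita : christoffels := fun i x c a b =>
  2^-1 * \sum_d invmx (g i x) c d *
    (partial a (fun y => g i y b d) x + partial b (fun y => g i y a d) x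
     - partial d (fun y => g i y a b) x).

(* R_abcd = g_ce R_ab^e_d *)
Definition riemann i x (a b c d : 'I_n) : R :=
  \sum_e g i x c e * curvature levi_civita i x a b e d.

(* For n = 2 the Gaussian curvature is the sectional curvature of T_x M. *)
Definition constant_gaussian_curvature : Prop :=
  exists K : R, forall i x, img i x -> forall u v : 'rV[R]_n,
    \sum_a \sum_b \sum_c \sum_d
      riemann i x a b c d * u 0 a * v 0 b * u 0 c * v 0 d =
    K * ((u *m g i x *m u^T) 0 0 * (v *m g i x *m v^T) 0 0
         - (u *m g i x *m v^T) 0 0 ^+ 2).

Definition einstein : Prop :=
  if n == 2%N then constant_gaussian_curvature
  else exists lambda : R, forall i x, img i x -> forall a b,
    ricci levi_civita i x a b = lambda * g i x a b.

End Metric.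

(* A section of S^2 T, where T is the dual of J^1 E(1), in the splitting
   S^2 T = S^2 TM(-2) + TM(-2) + E(-2) determined by a connection in p. *)
Record tractor := Tractor {
  t_sigma : chart A -> 'rV[R]_n -> 'M[R]_n;
  t_mu : chart A -> 'rV[R]_n -> 'I_n -> R;
  t_rho : chart A -> 'rV[R]_n -> R
}.

(* The three components of the tractor connection. *)
Definition tractor_conn1 (G : christoffels) (t : tractor) i x (a b c : 'I_n) : R :=
  nabla2 G (-2) (t_sigma t) i x a b c
  + kron a b * t_mu t i x c + kron a c * t_mu t i x b.

Definition tractor_conn2 (G : christoffels) (t : tractor) i x (a b : 'I_n) : R :=
  nabla1 G (-2) (t_mu t) i x a b + kron a b * t_rho t i x
  - \sum_c schouten G i x a c * t_sigma t i x b c.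

Definition tractor_conn3 (G : christoffels) (t : tractor) i x (a : 'I_n) : R :=
  nabla0 G (-2) (t_rho t) i x a - 2 * \sum_b schouten G i x a b * t_mu t i x b.

Definition parallel (G : christoffels) (t : tractor) : Prop :=
  forall i x, img i x ->
    [/\ forall a b c, tractor_conn1 G t i x a b c = 0,
        forall a b, tractor_conn2 G t i x a b = 0
      & forall a, tractor_conn3 G t i x a = 0].

Section Splitting.
Variables (G : christoffels) (sigma : S2TM (-2)).

Definition L_mu i x (b : 'I_n) : R :=
  - n.+1%:R^-1 * \sum_a nabla2 G (-2) sigma i x a a b.

Definition L_rho i x : R :=
  - n%:R^-1 * (\sum_a nabla1 G (-2) L_mu i x a a
               - \sum_a \sum_b schouten G i x a b * sigma i x a b).

Definition L : tractor := Tractor sigma L_mu L_rho.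

End Splitting.

Definition normal_solution (p : set affine_connection) (sigma : S2TM (-2)) : Prop :=
  forall G, p G -> parallel G (L G sigma).

(* The formulas for [L] agree with its characterisation: it is the unique
   lift of sigma whose covariant derivative has trace-free first two
   components. *)
Definition trace_free_derivative (G : christoffels) (t : tractor) : Prop :=
  forall i x, img i x ->
    (forall c, \sum_a tractor_conn1 G t i x a a c = 0) /\
    \sum_a tractor_conn2 G t i x a a = 0.

Lemma sum_kron (a : 'I_n) (F : 'I_n -> R) : \sum_b kron b a * F b = F a.
Proof.
rewrite (bigD1 a) //= /kron eqxx mul1r big1 ?addr0 // => b /negPf ->.
by rewrite mul0r.
Qed.

Lemma trace_conn1 (G : christoffels) (t : tractor) i x c :
  \sum_a tractor_conn1 G t i x a a c =
  \sum_a nabla2 G (-2) (t_sigma t) i x a a c + n.+1%:R * t_mu t i x c.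
Proof.
rewrite /tractor_conn1 !big_split /= -addrA sum_kron; congr (_ + _).
under eq_bigr do rewrite /kron eqxx mul1r.
by rewrite sumr_const card_ord -mulrSr mulr_natl.
Qed.

Lemma trace_conn2 (G : christoffels) (t : tractor) i x :
  \sum_a tractor_conn2 G t i x a a =
  \sum_a nabla1 G (-2) (t_mu t) i x a a + n%:R * t_rho t i x
  - \sum_a \sum_b schouten G i x a b * t_sigma t i x a b.
Proof.
rewrite /tractor_conn2 big_split /= sumrN; congr (_ - _).
rewrite big_split /=; congr (_ + _).
under eq_bigr do rewrite /kron eqxx mul1r.
by rewrite sumr_const card_ord mulr_natl.
Qed.

Lemma L_characterisation (G : christoffels) (sigma : S2TM (-2)) (t : tractor) :
  (0 < n)%N -> t_sigma t = sigma ->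
  trace_free_derivative G t <->
  (forall i x, img i x ->
     t_mu t i x = L_mu G sigma i x /\ t_rho t i x = L_rho G sigma i x).
Proof.
move=> n0 ts.
have nR : n%:R != 0 :> R by rewrite pnatr_eq0 -lt0n.
have eq_nabla1 i x : (forall y, img i y -> t_mu t i y = L_mu G sigma i y) ->
    img i x -> \sum_a nabla1 G (-2) (t_mu t) i x a a
             = \sum_a nabla1 G (-2) (L_mu G sigma) i x a a.
  move=> e ix; apply: eq_bigr => a _; rewrite /nabla1 !e //; congr (_ + _ + _).
  apply: near_eq_derive.
  have /filterS : nbhs x (img i).
    by apply: open_nbhs_nbhs; split=> //; exact: img_open.
  by apply=> y iy; rewrite e.
have mu_iff i x c : \sum_a tractor_conn1 G t i x a a c = 0 <->
    t_mu t i x c = L_mu G sigma i x c.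
  rewrite trace_conn1 ts /L_mu; set S := \sum_a _.
  have n1 : n.+1%:R != 0 :> R by rewrite pnatr_eq0.
  split=> [/eqP|->]; last by rewrite mulNr mulrN mulVKf // subrr.
  rewrite addrC addr_eq0 => /eqP e; rewrite mulNr -mulrN -e mulKf //.
have rho_iff i x : (forall y, img i y -> t_mu t i y = L_mu G sigma i y) ->
    img i x -> \sum_a tractor_conn2 G t i x a a = 0 <->
    t_rho t i x = L_rho G sigma i x.
  move=> e ix; rewrite trace_conn2 ts (eq_nabla1 i x e ix) /L_rho.
  set S := \sum_a nabla1 _ _ _ _ _ _ _; set T := \sum_a \sum_b _.
  split=> [/eqP|->]; last first.
    by rewrite mulNr mulrN mulVKf // addrAC subrr.
  by rewrite addrAC addrC addr_eq0 => /eqP e'; rewrite mulNr -mulrN -e' mulKf.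
split=> [h i x ix|h i x ix].
  have e y : img i y -> t_mu t i y = L_mu G sigma i y.
    by move=> iy; apply/funext => c; apply/mu_iff; exact: (h i y iy).1.
  by split; [exact: e|apply/rho_iff => //; exact: (h i x ix).2].
split=> [c|]; first by apply/mu_iff; rewrite (h i x ix).1.
by apply/(rho_iff i x) => [y iy||] //; [exact: (h i y iy).1|exact: (h i x ix).2].
Qed.

End Geometry.

(* Main.v *)
(* A connection of [p] and the Levi-Civita connection of [metric_of sigma] differ by
   Upsilon_a delta^c_b + Upsilon_b delta^c_a, where mu^b = sigma^bc Upsilon_c: this is the
   metricity equation. Upsilon is closed because both connections preserve volume forms,
   so the Schouten tensors are related by P^_ab = P_ab - nabla_a Upsilon_b + Upsilon_a Upsilon_b.
   The second component of the derivative of [L sigma] is then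
   rho^ delta_a^b - P^_ac sigma^bc with rho^ = rho - Upsilon_c mu^c, and vanishes exactly when
   P^ = lambda g, with lambda = tau rho^; in that case the third component is d lambda / tau.
   Hence each G in [p] can be treated on its own, without projective invariance of [L].
   That lambda does not depend on the chart follows from the tensoriality of the Ricci
   curvature, and connectedness makes it constant. On a surface the curvature is
   determined by the Ricci tensor, so that constant Gaussian curvature is Ric = K g. *)
Require Import Defs.
From mathcomp Require Import perm all_boot all_order all_algebra.
From mathcomp Require Import all_classical all_reals all_analysis.
From mathcomp Require Import ring lra.
Import Order.TTheory GRing.Theory Num.Theory numFieldNormedType.Exports.

Set Implicit Arguments.
Unset Strict Implicit.
Unset Printing Implicit Defensive.

Local Open Scope classical_set_scope.
Local Open Scope ring_scope.

(** * Smooth functions on an open set *)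

Section LocalCalculus.
Context {R : realType} {V : normedModType R}.
Implicit Types (W : normedModType R) (U : set V) (x v : V).

(** The obstacle is that everything is known only through components in charts, and [mu] and [rho]
    are given by formulas whose behaviour under a change of chart is not visible. The way out is to
    write Upsilon with logarithmic derivatives of [tau] and of a volume form omega parallel for G.
    This gives closedness at once. It also shows that the function tau^(n+1) omega^2, whose weights
    cancel, satisfies d f = -2(n+1) f Upsilon, so Upsilon transforms as a 1-form although no
    transformation law of [mu] has been established. The value of lambda is forced: rho is chosen so
    that the second component of the derivative of [L sigma] is trace-free, so if P^ = K g at a
    point, for any number K, then K = tau rho^ there. For n = 2 the proportionality of P^ and g is
    automatic, and the whole content lies in the constancy of K, that is, in the third component. *)

Lemma near_open U x : open U -> U x -> \forall y \near x, U y.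
Proof. by move=> oU Ux; apply: open_nbhs_nbhs. Qed.

(** The first order expansion of [f] at [x] is also one of [g], since the two agree near [x];
    uniqueness of the differential concludes. *)
Lemma near_differentiable W (f g : V -> W) x :
  (\near x, f x = g x) -> differentiable f x -> differentiable g x.
Proof.
move=> fg df; have e : g \o shift x = cst (g x) + 'd f x +o_ 0 id.
  apply/eqaddoP => eps eps0.
  have /eqaddoP/(_ eps eps0) := diff_locally df.
  have : \forall h \near (0 : V), f (h + x) = g (h + x).
    by have := fg; rewrite (near_shift 0) /= subr0.
  move=> h1 h2; apply: filterS2 h1 h2 => h.
  by rewrite !fctE /= => ->; rewrite (nbhs_singleton fg).
have dc : continuous ('d f x) by exact: diff_continuous.
by apply/diff_locallyP; rewrite (diff_unique dc e); split.
Qed.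

Lemma Ck_on_eq W k U (f g : V -> W) : open U -> (forall x, U x -> f x = g x) ->
  Ck_on k U f -> Ck_on k U g.
Proof.
move=> oU; have near_fg (f' g' : V -> W) x : (forall x, U x -> f' x = g' x) -> U x ->
    \near x, f' x = g' x.
  by move=> h Ux; apply: filterS (near_open oU Ux) => y /h.
elim: k f g => [f g fg cf x Ux|k IH f g fg [df Df]].
  have n := near_fg f g x fg Ux.
  rewrite /prop_for /continuous_at -fg //; apply: cvg_trans (cf x Ux).
  by apply: near_eq_cvg.
split=> [x Ux|v].
  by apply: (near_differentiable (near_fg f g x fg Ux)); exact: df.
apply: IH (Df v) => x Ux; apply: near_eq_derive; exact: near_fg.
Qed.

Lemma Ck_onW W k U (f : V -> W) : Ck_on k.+1 U f -> Ck_on k U f.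
Proof.
elim: k f => [f [df _] x Ux|k IH f [df Df]].
  exact: differentiable_continuous (df x Ux).
by split=> // v; apply: IH.
Qed.

Section Scalar.
Variable U : set V.
Hypothesis oU : open U.
Implicit Types f g : V -> R.

Lemma smooth_differentiable W (f : V -> W) x : smooth_on U f -> U x -> differentiable f x.
Proof. by move=> sf Ux; have [df _] := sf 1%N; exact: df. Qed.

Lemma smooth_derive W (f : V -> W) v : smooth_on U f -> smooth_on U ('D_v f).
Proof. by move=> sf k; have [_ /(_ v)] := sf k.+1. Qed.

Lemma smooth_eq W (f g : V -> W) : (forall x, U x -> f x = g x) ->
  smooth_on U f -> smooth_on U g.
Proof. by move=> fg sf k; exact: Ck_on_eq (sf k). Qed.

Lemma Ck_on_cst k (c : R) : Ck_on k U (fun _ : V => c).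
Proof.
elim: k c => [|k IH] c; first by move=> x _; exact: cst_continuous.
split=> [x _|v]; first exact: differentiable_cst.
by apply: Ck_on_eq (IH 0) => // x _; rewrite derive_cst.
Qed.

Lemma smooth_cst (c : R) : smooth_on U (fun _ : V => c).
Proof. by move=> k; exact: Ck_on_cst. Qed.

Lemma Ck_onD k f g : Ck_on k U f -> Ck_on k U g -> Ck_on k U (fun x => f x + g x).
Proof.
elim: k f g => [|k IH] f g.
  by move=> cf cg x Ux; exact: continuousD (cf x Ux) (cg x Ux).
move=> [df Df] [dg Dg]; split=> [x Ux|v].
  exact: differentiableD (df x Ux) (dg x Ux).
apply: Ck_on_eq (IH _ _ (Df v) (Dg v)) => // x Ux.
by rewrite -deriveD //; apply: diff_derivable; [exact: df|exact: dg].
Qed.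

Lemma Ck_onM k f g : Ck_on k U f -> Ck_on k U g -> Ck_on k U (fun x => f x * g x).
Proof.
elim: k f g => [|k IH] f g.
  by move=> cf cg x Ux; exact: continuousM (cf x Ux) (cg x Ux).
move=> Cf Cg; have [df Df] := Cf; have [dg Dg] := Cg.
split=> [x Ux|v]; first exact: differentiableM (df x Ux) (dg x Ux).
(* The undifferentiated factors of the Leibniz rule are of order k+1 and are weakened to order k,
   where the induction hypothesis applies. *)
apply: Ck_on_eq (Ck_onD (IH _ _ (Ck_onW Cf) (Dg v)) (IH _ _ (Ck_onW Cg) (Df v))) => //.
move=> x Ux; rewrite -[RHS]/('D_v (f * g) x) deriveM //; apply: diff_derivable;
  [exact: df|exact: dg].
Qed.

Lemma smoothD f g : smooth_on U f -> smooth_on U g ->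
  smooth_on U (fun x => f x + g x).
Proof. by move=> sf sg k; exact: Ck_onD. Qed.

Lemma smoothM f g : smooth_on U f -> smooth_on U g ->
  smooth_on U (fun x => f x * g x).
Proof. by move=> sf sg k; exact: Ck_onM. Qed.

Lemma smoothZ (c : R) f : smooth_on U f -> smooth_on U (fun x => c * f x).
Proof. by move=> sf; apply: smoothM => //; exact: smooth_cst. Qed.

Lemma smoothX f k : smooth_on U f -> smooth_on U (fun x => f x ^+ k).
Proof.
move=> sf; elim: k => [|k IH]; first exact: smooth_cst.
by apply: smooth_eq (smoothM sf IH) => x _; rewrite exprS.
Qed.

Lemma smoothN f : smooth_on U f -> smooth_on U (fun x => - f x).
Proof.
move=> sf; apply: smooth_eq (smoothM (smooth_cst (-1)) sf) => x _.
by rewrite mulN1r.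
Qed.

Lemma smoothB f g : smooth_on U f -> smooth_on U g ->
  smooth_on U (fun x => f x - g x).
Proof. by move=> sf sg; apply: smoothD => //; exact: smoothN. Qed.

(** The derivative -(1/f)^2 D_v f involves 1/f only at the lower order, so the induction on the
    order keeps [f] fixed. *)
Lemma smoothV f : (forall x, U x -> f x != 0) -> smooth_on U f ->
  smooth_on U (fun x => (f x)^-1).
Proof.
move=> f0 sf k; elim: k => [|k IH].
  by move=> x Ux; apply: continuousV; [exact: f0|exact: (sf 0)].
split=> [x Ux|v].
  by apply: differentiableV; [exact: smooth_differentiable Ux|exact: f0].
apply: Ck_on_eq (Ck_onM (Ck_onM (Ck_on_cst k (-1)) (Ck_onM IH IH))
                   (smooth_derive v sf k)) => // x Ux.
rewrite deriveV ?f0 //; last exact: diff_derivable (smooth_differentiable sf Ux).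
by rewrite mulN1r /GRing.scale /= -expr2 exprVn.
Qed.

Lemma smooth_sum (I : Type) (r : seq I) (P : pred I) (F : I -> V -> R) :
  (forall i, P i -> smooth_on U (F i)) -> smooth_on U (fun x => \sum_(i <- r | P i) F i x).
Proof.
move=> sF; elim: r => [|i r IH].
  by apply: smooth_eq (smooth_cst 0) => x _; rewrite big_nil.
case Pi: (P i); last by apply: smooth_eq IH => x _; rewrite big_cons Pi.
by apply: smooth_eq (smoothD (sF i Pi) IH) => x _; rewrite big_cons Pi.
Qed.

Lemma smooth_prod (I : Type) (r : seq I) (F : I -> V -> R) :
  (forall i, smooth_on U (F i)) -> smooth_on U (fun x => \prod_(i <- r) F i x).
Proof.
move=> sF; elim: r => [|i r IH].
  by apply: smooth_eq (smooth_cst 1) => x _; rewrite big_nil.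
by apply: smooth_eq (smoothM (sF i) IH) => x _; rewrite big_cons.
Qed.

Lemma smooth_det n (B : V -> 'M[R]_n) : (forall a b, smooth_on U (fun x => B x a b)) ->
  smooth_on U (fun x => \det (B x)).
Proof.
move=> sB; apply: smooth_sum => s _; apply: smoothM; first exact: smooth_cst.
exact: smooth_prod.
Qed.

Lemma smooth_cofactor n (B : V -> 'M[R]_n) a b :
  (forall a b, smooth_on U (fun x => B x a b)) ->
  smooth_on U (fun x => cofactor (B x) a b).
Proof.
move=> sB; apply: smoothM; first exact: smooth_cst.
apply: smooth_det => c d.
by apply: smooth_eq (sB (lift a c) (lift b d)) => x _; rewrite !mxE.
Qed.

Lemma smooth_invmx n (B : V -> 'M[R]_n) a b :
  (forall x, U x -> B x \in unitmx) ->
  (forall a b, smooth_on U (fun x => B x a b)) ->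
  smooth_on U (fun x => invmx (B x) a b).
Proof.
move=> uB sB.
have sdet := smooth_det sB.
apply: smooth_eq (smoothM (smoothV _ sdet) (smooth_cofactor b a sB)) => x Ux.
  by rewrite /invmx uB // !mxE.
by have := uB x Ux; rewrite unitmxE unitfE.
Qed.

End Scalar.
End LocalCalculus.

(** * Mixed derivatives, chain rule, locally constant functions *)

Section Lines.
Context {R : realType} {V : normedModType R}.
Implicit Types (U : set V) (x y u v : V) (f : V -> R).

Lemma is_derive_line f y v (t : R) : differentiable f (y + t *: v) ->
  is_derive t 1 (fun s : R => f (y + s *: v)) ('D_v f (y + t *: v)).
Proof.
move=> /(@diff_derivable _ _ _ f (y + t *: v) v) df.
have e : (fun h : R => h^-1 *: (((fun s : R => f (y + s *: v)) \o shift t) (h *: (1 : R)) -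
      f (y + t *: v))) = (fun h : R => h^-1 *: ((f \o shift (y + t *: v)) (h *: v) - f (y + t *: v))).
  apply/funext => h /=; congr (_ *: (f _ - _)).
  by rewrite [h%:A]mulr1 scalerDl addrCA.
by apply: DeriveDef; rewrite /derivable /derive e.
Qed.

Lemma mean_value_line f y v (h : R) : 0 <= h ->
  (forall t, 0 <= t <= h -> differentiable f (y + t *: v)) ->
  exists2 t, 0 <= t <= h & f (y + h *: v) - f y = 'D_v f (y + t *: v) * h.
Proof.
move=> h0 df.
have [|||t] := @MVT_segment R (fun s => f (y + s *: v)) (fun s => 'D_v f (y + s *: v)) 0 h.
- by [].
- move=> t; rewrite in_itv /= => /andP[t0 th]; apply: is_derive_line.
  by apply: df; rewrite !ltW.
- apply: derivable_within_continuous => t; rewrite in_itv /= => th.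
  by have [] := is_derive_line (df t th).
by rewrite in_itv /= scale0r addr0 subr0 => th e; exists t.
Qed.

(** The mean value theorem is used twice: in the direction u for the difference [F] of [f] along two
    parallel sides, then in the direction v for D_u f. *)
Lemma second_difference U f x u v (h : R) : 0 <= h -> Ck_on 2 U f ->
  (forall s t, 0 <= s <= h -> 0 <= t <= h -> U (x + s *: u + t *: v)) ->
  exists s t, [/\ 0 <= s <= h, 0 <= t <= h &
    f (x + h *: u + h *: v) - f (x + h *: u) - (f (x + h *: v) - f x) =
    'D_v ('D_u f) (x + s *: u + t *: v) * (h * h)].
Proof.
move=> h0 [df Df] Ust; have [Ddf _] := Df u.
have hh : 0 <= h <= h by rewrite h0 lexx.
have h00 : 0 <= (0 : R) <= h by rewrite lexx h0.
have Us s : 0 <= s <= h -> U (x + s *: u).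
  by move=> sh; have := Ust s 0 sh h00; rewrite scale0r addr0.
pose F (s : R) := f (x + h *: v + s *: u) - f (x + s *: u).
have dF s : 0 <= s <= h ->
    is_derive s 1 F ('D_u f (x + h *: v + s *: u) - 'D_u f (x + s *: u)).
  move=> sh; apply: is_deriveB; apply: is_derive_line; apply: df.
    by rewrite addrAC; apply: Ust.
  exact: Us.
have [|||s] := @MVT_segment R F (fun s => 'D_u f (x + h *: v + s *: u) - 'D_u f (x + s *: u)) 0 h.
- by [].
- by move=> s; rewrite in_itv /= => /andP[t0 th]; apply: dF; rewrite !ltW.
- apply: derivable_within_continuous => t; rewrite in_itv /= => th.
  by have [] := dF t th.
rewrite in_itv /= => sh; rewrite subr0 /F scale0r !addr0 => e.
have [t th et] := @mean_value_line ('D_u f) (x + s *: u) v h h0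
  (fun t th => Ddf _ (Ust s t sh th)).
exists s, t; split=> //; rewrite mulrA -et -addrA.
rewrite [x + s *: u + _]addrAC -e.
by rewrite [x + h *: u + _]addrAC; ring.
Qed.

Lemma near_rectangle x u v (P : V -> Prop) : (\forall y \near x, P y) ->
  exists2 h : R, 0 < h & forall s t, 0 <= s <= h -> 0 <= t <= h -> P (x + s *: u + t *: v).
Proof.
move=> /nbhs_ballP [r r0 rP]; have K0 : 0 < `|u| + `|v| + 1.
  by rewrite ltr_wpDl // addr_ge0.
(* The summand 1 keeps the denominator positive when u = v = 0; the factor 1/2 makes the final
   inequality strict. *)
exists (r / (`|u| + `|v| + 1) / 2); first by rewrite !divr_gt0.
have hK : r / (`|u| + `|v| + 1) * (`|u| + `|v| + 1) = r by rewrite divfK ?gt_eqF.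
set h := _ / 2; have h0 : 0 < h by rewrite !divr_gt0.
move=> s t /andP[s0 sh] /andP[t0 th]; apply: rP; rewrite -ball_normE /=.
rewrite -addrA opprD addNKr normrN.
apply: le_lt_trans (ler_normD _ _) _; rewrite !normrZ !ger0_norm //.
apply: (@le_lt_trans _ _ (h * (`|u| + `|v|))).
  by rewrite mulrDr lerD // ler_wpM2r.
have : h * 2 * (`|u| + `|v| + 1) = r by rewrite /h divfK ?pnatr_eq0.
have := normr_ge0 u; have := normr_ge0 v; nra.
Qed.

(** The second difference is symmetric in u and v, so the two mixed derivatives take a common value
    at points of an arbitrarily small parallelogram; continuity of both at x concludes. *)
Lemma derive_comm U f x u v : open U -> smooth_on U f -> U x ->
  'D_u ('D_v f) x = 'D_v ('D_u f) x.
Proof.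
move=> oU sf Ux; apply/eqP; rewrite -subr_eq0 -normr_eq0; apply/eqP/le_anti.
rewrite normr_ge0 andbT; apply/ler_addgt0Pl => e e0; rewrite addr0.
have c1 : {for x, continuous ('D_u ('D_v f))}.
  by have := smooth_derive u (smooth_derive v sf); move=> /(_ 0); apply.
have c2 : {for x, continuous ('D_v ('D_u f))}.
  by have := smooth_derive v (smooth_derive u sf); move=> /(_ 0); apply.
have e2 : 0 < e / 2 by rewrite divr_gt0.
have [h h0 Ph] := near_rectangle u v (filterI (near_open oU Ux)
  (filterI (cvgr_dist_lt _ _ c1 _ e2) (cvgr_dist_lt _ _ c2 _ e2))).
have Q s t : 0 <= s <= h -> 0 <= t <= h -> U (x + s *: v + t *: u).
  by move=> sh th; rewrite addrAC; have [] := Ph t s th sh.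
have [s [t [sh th e1]]] := second_difference (ltW h0) (sf 2) (fun s t a b => (Ph s t a b).1).
have [s' [t' [sh' th' e1']]] := second_difference (ltW h0) (sf 2) Q.
have : 'D_v ('D_u f) (x + s *: u + t *: v) = 'D_u ('D_v f) (x + s' *: v + t' *: u).
  apply: (@mulIf _ (h * h)); first by rewrite mulf_neq0 // gt_eqF.
  apply: (etrans (esym e1)); apply: (etrans _ e1'); rewrite (addrAC x (h *: v)).
  by rewrite !opprB !addrA addrAC [X in X + _]addrAC addrAC.
have [_ [+ _]] := Ph _ _ th' sh'; have [_ [_]] := Ph _ _ sh th.
rewrite [x + t' *: u + _]addrAC.
set a := 'D_v _ x; set b := 'D_u _ x.
move=> h1 h2 h3; rewrite h3 in h1; apply: ltW.
by rewrite (splitr e); apply: (le_lt_trans (ler_distD _ _ _) (ltrD h2 _)); rewrite distrC.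
Qed.

End Lines.

Section Partial.
Context {R : realType} {n : nat}.
Implicit Types (U : set 'rV[R]_n) (x : 'rV[R]_n) (f g : 'rV[R]_n -> R) (a b : 'I_n).

Lemma partial_eq U f g x a : open U -> U x -> (forall y, U y -> f y = g y) ->
  partial a f x = partial a g x.
Proof.
by move=> oU Ux fg; apply: near_eq_derive; apply: filterS (near_open oU Ux) => y /fg.
Qed.

Lemma partial_cst (c : R) x a : partial a (fun _ => c) x = 0.
Proof. by rewrite /partial derive_cst. Qed.

Lemma partialD f g x a : differentiable f x -> differentiable g x ->
  partial a (fun y => f y + g y) x = partial a f x + partial a g x.
Proof. by move=> df dg; rewrite -deriveD //; exact: diff_derivable. Qed.

Lemma partialN f x a : differentiable f x ->
  partial a (fun y => - f y) x = - partial a f x.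
Proof. by move=> df; rewrite -deriveN //; exact: diff_derivable. Qed.

Lemma partialB f g x a : differentiable f x -> differentiable g x ->
  partial a (fun y => f y - g y) x = partial a f x - partial a g x.
Proof. by move=> df dg; rewrite -deriveB //; exact: diff_derivable. Qed.

Lemma partialM f g x a : differentiable f x -> differentiable g x ->
  partial a (fun y => f y * g y) x = partial a f x * g x + f x * partial a g x.
Proof.
move=> df dg; rewrite -[LHS]/('D_('e_a) (f * g) x) deriveM; try exact: diff_derivable.
by rewrite addrC [in LHS]/GRing.scale /= mulrC.
Qed.

Lemma differentiable_mull (c : R) f x : differentiable f x ->
  differentiable (fun y => c * f y) x.
Proof. by move=> df; apply: differentiableM => //; exact: differentiable_cst. Qed.

Lemma partialZ (c : R) f x a : differentiable f x ->
  partial a (fun y => c * f y) x = c * partial a f x.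
Proof. by move=> df; rewrite partialM // partial_cst mul0r add0r. Qed.

Lemma differentiable_pow f k x : differentiable f x ->
  differentiable (fun y => f y ^+ k) x.
Proof.
move=> df; elim: k => [|k IH]; first exact: differentiable_cst.
rewrite (_ : (fun y => _) = f * (fun y => f y ^+ k)); first exact: differentiableM.
by apply/funext => y; rewrite exprS.
Qed.

Lemma partialX f k x a : differentiable f x ->
  partial a (fun y => f y ^+ k) x = k%:R * f x ^+ k.-1 * partial a f x.
Proof.
move=> df; rewrite /partial (_ : (fun y => f y ^+ k) = f ^+ k).
  by rewrite deriveX //; exact: diff_derivable.
by apply/funext => y; rewrite exprfctE.
Qed.

Lemma partialV f x a : differentiable f x -> f x != 0 ->
  partial a (fun y => (f y)^-1) x = - partial a f x / f x ^+ 2.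
Proof.
move=> df f0; rewrite /partial deriveV //; last exact: diff_derivable.
by rewrite /GRing.scale /= mulNr mulrC mulNr.
Qed.

Lemma differentiable_bigsum (I : Type) (r : seq I) (P : pred I) (F : I -> 'rV[R]_n -> R) x :
  (forall i, differentiable (F i) x) -> differentiable (fun y => \sum_(i <- r | P i) F i y) x.
Proof.
move=> dF; elim: r => [|i r IH].
  have -> : (fun y => \sum_(i <- [::] | P i) F i y) = cst 0.
    by apply/funext => y; rewrite big_nil.
  exact: differentiable_cst.
case Pi: (P i); last first.
  by rewrite (_ : (fun y => _) = (fun y => \sum_(i <- r | P i) F i y)) //;
     apply/funext => y; rewrite big_cons Pi.
have -> : (fun y => \sum_(i <- i :: r | P i) F i y) = F i + (fun y => \sum_(i <- r | P i) F i y).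
  by apply/funext => y; rewrite big_cons Pi.
exact: differentiableD.
Qed.

Lemma partial_sum (I : Type) (r : seq I) (P : pred I) (F : I -> 'rV[R]_n -> R) x a :
  (forall i, differentiable (F i) x) ->
  partial a (fun y => \sum_(i <- r | P i) F i y) x = \sum_(i <- r | P i) partial a (F i) x.
Proof.
move=> dF; elim: r => [|i r IH].
  rewrite big_nil -[RHS](partial_cst 0 x a); congr (partial a _ x).
  by apply/funext => y; rewrite big_nil.
rewrite big_cons -IH; case Pi: (P i); last first.
  by congr (partial a _ x); apply/funext => y; rewrite big_cons Pi.
rewrite -partialD //; last exact: differentiable_bigsum.
by congr (partial a _ x); apply/funext => y; rewrite big_cons Pi.
Qed.

Lemma partial_comm U f x a b : open U -> smooth_on U f -> U x ->
  partial a (partial b f) x = partial b (partial a f) x.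
Proof. exact: derive_comm. Qed.

Lemma partial_comp m (phi : 'rV[R]_n -> 'rV[R]_m) (f : 'rV[R]_m -> R) x a :
  differentiable phi x -> differentiable f (phi x) ->
  partial a (fun y => f (phi y)) x =
  \sum_b partial a (fun y => phi y 0 b) x * partial b f (phi x).
Proof.
move=> dphi df; rewrite -[LHS]/('D_('e_a) (f \o phi) x) deriveE; last first.
  exact: differentiable_comp.
have e := derive_mx (@diff_derivable _ _ _ phi x 'e_a dphi); rewrite deriveE // in e.
rewrite diff_comp //= e; set w := \matrix_(i, j) _.
rewrite (row_sum_delta w) linear_sum /=; apply: eq_bigr => b _.
by rewrite linearZ /= mxE /partial (deriveE _ df).
Qed.

Lemma derive_partial f x (v : 'rV[R]_n) : differentiable f x ->
  'D_v f x = \sum_a v 0 a * partial a f x.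
Proof.
move=> df; rewrite deriveE // {1}(row_sum_delta v) linear_sum /=.
by apply: eq_bigr => a _; rewrite linearZ /= /partial deriveE.
Qed.

Lemma partial0_locally_cst U f x : open U -> U x ->
  (forall y, U y -> differentiable f y) -> (forall y, U y -> forall a, partial a f y = 0) ->
  \forall y \near x, f y = f x.
Proof.
move=> oU Ux df f0; have /nbhs_ballP [r r0 rU] := near_open oU Ux.
apply/nbhs_ballP; exists r => // y xy.
have Ut t : 0 <= t <= 1 -> U (x + t *: (y - x)).
  move=> /andP[t0 t1]; apply: rU; move: xy; rewrite -!ball_normE /= opprD addNKr normrN.
  rewrite normrZ ger0_norm // distrC => xy.
  by apply: le_lt_trans xy; rewrite ler_piMl.
have [t /Ut Utt] := mean_value_line ler01 (fun t th => df _ (Ut t th)).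
rewrite scale1r subrKC derive_partial; last exact: df.
by rewrite big1 ?mul0r => [/eqP|a _]; [rewrite subr_eq0 => /eqP|rewrite f0 ?mulr0].
Qed.

End Partial.

(** * Derivatives of matrices and determinants *)

Section MatrixDerivatives.
Context {R : realType} {n : nat}.
Implicit Types (U : set 'rV[R]_n) (x : 'rV[R]_n) (a : 'I_n).

Definition dmx p q a (B : 'rV[R]_n -> 'M[R]_(p, q)) x : 'M[R]_(p, q) :=
  \matrix_(i, j) partial a (fun y => B y i j) x.

Lemma dmx_eq p q U (B C : 'rV[R]_n -> 'M[R]_(p, q)) x a : open U -> U x ->
  (forall y, U y -> B y = C y) -> dmx a B x = dmx a C x.
Proof.
move=> oU Ux BC; apply/matrixP => i j; rewrite !mxE.
by apply: partial_eq oU Ux _ => y /BC ->.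
Qed.

Lemma dmxM p q r (B : 'rV[R]_n -> 'M[R]_(p, q)) (C : 'rV[R]_n -> 'M[R]_(q, r)) x a :
  (forall i j, differentiable (fun y => B y i j) x) ->
  (forall i j, differentiable (fun y => C y i j) x) ->
  dmx a (fun y => B y *m C y) x = dmx a B x *m C x + B x *m dmx a C x.
Proof.
move=> dB dC; apply/matrixP => i j; rewrite !mxE.
transitivity (partial a (fun y => \sum_k B y i k * C y k j) x).
  by congr (partial a _ x); apply/funext => y; rewrite mxE.
rewrite partial_sum => [|k]; last exact: differentiableM.
by rewrite -big_split /=; apply: eq_bigr => k _; rewrite partialM // !mxE.
Qed.

Lemma dmxZ p q (f : 'rV[R]_n -> R) (B : 'rV[R]_n -> 'M[R]_(p, q)) x a :
  differentiable f x -> (forall i j, differentiable (fun y => B y i j) x) ->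
  dmx a (fun y => f y *: B y) x = partial a f x *: B x + f x *: dmx a B x.
Proof.
move=> df dB; apply/matrixP => i j; rewrite !mxE -partialM //.
by congr (partial a _ x); apply/funext => y; rewrite mxE.
Qed.

Lemma dmx_cst p q (B : 'M[R]_(p, q)) x a : dmx a (fun _ => B) x = 0.
Proof. by apply/matrixP => i j; rewrite !mxE partial_cst. Qed.

(** Differentiate B^-1 B = 1. *)
Lemma dmx_inv q U (B : 'rV[R]_n -> 'M[R]_q) x a : open U -> U x ->
  (forall i j, smooth_on U (fun y => B y i j)) -> (forall y, U y -> B y \in unitmx) ->
  dmx a (fun y => invmx (B y)) x = - (invmx (B x) *m dmx a B x *m invmx (B x)).
Proof.
move=> oU Ux sB uB.
have dB i j := smooth_differentiable (sB i j) Ux.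
have dI i j := smooth_differentiable (smooth_invmx oU i j uB sB) Ux.
have := dmxM a dI dB; rewrite (@dmx_eq _ _ U _ (fun _ => 1%:M)) //; last first.
  by move=> y /uB Uy; rewrite mulVmx.
rewrite dmx_cst => /esym/eqP; rewrite addr_eq0 => /eqP /(congr1 (mulmx^~ (invmx (B x)))).
by rewrite mulmxK ?uB // mulNmx.
Qed.

Lemma differentiable_bigprod (I : Type) (r : seq I) (F : I -> 'rV[R]_n -> R) x :
  (forall i, differentiable (F i) x) -> differentiable (fun y => \prod_(i <- r) F i y) x.
Proof.
move=> dF; elim: r => [|i r IH].
  rewrite (_ : (fun y => _) = cst 1); first exact: differentiable_cst.
  by apply/funext => y; rewrite big_nil.
have -> : (fun y => \prod_(i <- i :: r) F i y) = F i * (fun y => \prod_(i <- r) F i y).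
  by apply/funext => y; rewrite big_cons.
exact: differentiableM.
Qed.

Lemma partial_prod (I : eqType) (r : seq I) (F : I -> 'rV[R]_n -> R) x a : uniq r ->
  (forall i, differentiable (F i) x) ->
  partial a (fun y => \prod_(i <- r) F i y) x =
  \sum_(i <- r) partial a (F i) x * \prod_(j <- r | j != i) F j x.
Proof.
move=> + dF; elim: r => [_|i r IH /= /andP[ir ur]].
  rewrite big_nil -[RHS](partial_cst 1 x a); congr (partial a _ x).
  by apply/funext => y; rewrite big_nil.
have -> : (fun y => \prod_(i <- i :: r) F i y) = (fun y => F i y * \prod_(i <- r) F i y).
  by apply/funext => y; rewrite big_cons.
rewrite partialM ?IH //; last exact: differentiable_bigprod.
rewrite big_cons big_cons eqxx /=; congr (_ * _ + _).
  rewrite big_seq [RHS]big_seq_cond; apply: eq_bigl => j.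
  by case: (boolP (j \in r)) => //= jr; apply/esym; apply: contra ir => /eqP <-.
rewrite big_distrr /= big_seq [RHS]big_seq; apply: eq_bigr => j jr.
rewrite big_cons ifT; first by rewrite mulrCA.
by apply: contra ir => /eqP ->.
Qed.

Lemma partial_det_cofactor q (B : 'rV[R]_n -> 'M[R]_q) x a :
  (forall i j, differentiable (fun y => B y i j) x) ->
  partial a (fun y => \det (B y)) x =
  \sum_i \sum_j partial a (fun y => B y i j) x * cofactor (B x) i j.
Proof.
move=> dB; rewrite /determinant partial_sum => [|s]; last first.
  apply: differentiableM; first exact: differentiable_cst.
  exact: differentiable_bigprod.
(* [C k] is B with row k differentiated. Expanded along that row, its determinant involves only
   cofactors of B, which do not see row k. *)
pose C (k : 'I_q) : 'M[R]_q :=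
  \matrix_(i, j) if i == k then partial a (fun y => B y i j) x else B x i j.
transitivity (\sum_k \det (C k)); last first.
  apply: eq_bigr => k _; rewrite (expand_det_row _ k); apply: eq_bigr => j _.
  rewrite !mxE eqxx; congr (_ * (_ * \det _)); apply/matrixP => i l.
  by rewrite !mxE eq_sym (negPf (neq_lift _ _)).
rewrite exchange_big /=; apply: eq_bigr => s _.
rewrite partialZ; last exact: differentiable_bigprod.
rewrite partial_prod ?index_enum_uniq // big_distrr /=; apply: eq_bigr => k _.
rewrite [in RHS](bigD1 k) //= mxE eqxx; congr (_ * (_ * _)); apply: eq_bigr => l lk.
by rewrite mxE (negPf lk).
Qed.

Lemma partial_det q (B : 'rV[R]_n -> 'M[R]_q) x a :
  (forall i j, differentiable (fun y => B y i j) x) -> B x \in unitmx ->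
  partial a (fun y => \det (B y)) x = \det (B x) * \tr (dmx a B x *m invmx (B x)).
Proof.
move=> dB uB; rewrite partial_det_cofactor // /mxtrace big_distrr /=.
have d0 : \det (B x) != 0 by move: uB; rewrite unitmxE unitfE.
apply: eq_bigr => i _; rewrite mxE big_distrr /=; apply: eq_bigr => j _.
by rewrite /invmx uB !mxE [RHS]mulrCA mulVKf.
Qed.

(** This is the closedness of d log |f|, written with quotients so that the sign of f does not
    matter. *)
Lemma partial_log_comm U (f : 'rV[R]_n -> R) x a b : open U -> U x ->
  smooth_on U f -> (forall y, U y -> f y != 0) ->
  partial b (fun y => partial a f y / f y) x = partial a (fun y => partial b f y / f y) x.
Proof.
move=> oU Ux sf f0; have df := smooth_differentiable sf Ux.
have dpf c := smooth_differentiable (smooth_derive 'e_c sf) Ux.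
have dVf := differentiableV df (f0 _ Ux).
rewrite !partialM ?(partialV _ df (f0 _ Ux)) //; try exact: dpf.
by rewrite (partial_comm b a oU sf Ux); field; exact: f0.
Qed.

End MatrixDerivatives.

(** * The Levi-Civita symbol, and [tau] as a constant multiple of the determinant *)

Section Epsilon.
Context {R : realType} {n : nat}.

Lemma det_sum_epsilon (C : 'M[R]_n) :
  \det C = \sum_(b : {ffun 'I_n -> 'I_n}) (\prod_k C k (b k)) * epsilon R b.
Proof.
(* Each permutation s becomes a sum over all maps b, in which the product of Kronecker symbols keeps
   only b = s. *)
transitivity (\sum_(s : 'S_n) \sum_(b : {ffun 'I_n -> 'I_n})
    (-1) ^+ s * \prod_k (C k (b k) * kron R (b k) (s k))).
  apply: eq_bigr => s _; rewrite -big_distrr /=; congr (_ * _).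
  rewrite -(bigA_distr_bigA (fun k l => C k l * kron R l (s k))) /=.
  apply: eq_bigr => k _; rewrite -(sum_kron (s k) (C k)).
  by apply: eq_bigr => l _; rewrite mulrC.
rewrite exchange_big /=; apply: eq_bigr => b _; rewrite big_distrr /=.
apply: eq_bigr => s _; rewrite big_split /= mulrCA; congr (_ * (_ * _)).
by apply: eq_bigr => k _; rewrite mxE.
Qed.

(** The value is n!, each permutation contributing 1; only its positivity is used. *)
Definition epsilon_norm : R := \sum_(a : {ffun 'I_n -> 'I_n}) epsilon R a ^+ 2.

Lemma epsilon_norm_gt0 : 0 < epsilon_norm.
Proof.
rewrite /epsilon_norm (bigD1 [ffun k => k]) //= ltr_wpDr //.
  by apply: sumr_ge0 => a _; exact: sqr_ge0.
have -> : epsilon R [ffun k : 'I_n => k] = 1.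
  apply: etrans (det1 R n); congr (\det _); apply/matrixP => k l.
  by rewrite !mxE ffunE.
by rewrite expr1n.
Qed.

(** For a fixed map a, the sum over b is the determinant of the matrix with rows C_(a k), which is
    epsilon(a) det C. *)
Lemma sum_epsilon_det (C : 'M[R]_n) :
  \sum_(a : {ffun 'I_n -> 'I_n}) \sum_(b : {ffun 'I_n -> 'I_n})
    (\prod_k C (a k) (b k)) * epsilon R a * epsilon R b = epsilon_norm * \det C.
Proof.
rewrite /epsilon_norm big_distrl /=; apply: eq_bigr => a _.
have -> : epsilon R a ^+ 2 * \det C = epsilon R a * \det (\matrix_(k, l) C (a k) l).
  rewrite expr2 -mulrA; congr (_ * _); rewrite /epsilon -det_mulmx.
  congr (\det _); apply/matrixP => k l; rewrite !mxE -(sum_kron (a k) (fun l' => C l' l)).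
  by apply: eq_bigr => m _; rewrite !mxE /kron eq_sym.
rewrite det_sum_epsilon big_distrr /=; apply: eq_bigr => b _.
rewrite [RHS]mulrA [epsilon R a * _]mulrC; congr (_ * _ * _).
by apply: eq_bigr => k _; rewrite mxE.
Qed.

End Epsilon.

(** * Computations in a chart *)

Lemma kronC (R : realType) n (a b : 'I_n) : kron R a b = kron R b a.
Proof. by rewrite /kron eq_sym. Qed.

Lemma kron_sum (R : realType) n (a : 'I_n) (F : 'I_n -> R) :
  \sum_b kron R a b * F b = F a.
Proof. by rewrite -[RHS](sum_kron a F); apply: eq_bigr => b _; rewrite kronC. Qed.

Lemma kernel0_unitmx (F : fieldType) n (B : 'M[F]_n) :
  (forall u : 'rV_n, u *m B = 0 -> u = 0) -> B \in unitmx.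
Proof.
move=> B0; rewrite -row_free_unit -kermx_eq0; apply/eqP/row_matrixP => k.
by rewrite row0; apply: B0; rewrite -row_mul mulmx_ker row0.
Qed.

Lemma open_img (R : realType) n (M : topologicalType) (A : smooth_atlas R n M) (i : chart A) :
  open (img i).
Proof. exact: img_open. Qed.
Arguments open_img {R n M A} i.

Section Chart.
Context {R : realType} {n : nat} {M : topologicalType} {A : smooth_atlas R n M}.
Variables (G : christoffels A) (sigma : S2TM A (-2)).
Hypothesis n_ge2 : (2 <= n)%N.
Hypothesis G_smooth : forall i c a b, smooth_on (img i) (fun x => G i x c a b).
Hypothesis G_torsion_free : torsion_free G.
Hypothesis sigma_nondegenerate : nondegenerate_section sigma.
Hypothesis sigma_metricity : forall i x, img i x -> forall a b c,
  metricity_op G sigma i x a b c = 0.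
Implicit Types (i : chart A) (x : 'rV[R]_n) (a b c d : 'I_n).

Let t := christoffel_trace G.
Let mu := L_mu G sigma.
Let rho := L_rho G sigma.
Let P := schouten G.

Lemma sigma_unitmx i x : img i x -> sigma i x \in unitmx.
Proof.
move=> ix; apply: kernel0_unitmx => u us; apply: (sigma_nondegenerate ix) => v.
by rewrite us mul0mx mxE.
Qed.

Lemma sigma_symE i x b c : img i x -> sigma i x b c = sigma i x c b.
Proof. by move=> ix; rewrite -[in LHS](bivec_sym sigma ix) mxE. Qed.

Lemma tauE i x : tau sigma i x = epsilon_norm (R := R) (n := n) * \det (sigma i x).
Proof. exact: sum_epsilon_det. Qed.

Lemma tau_neq0 i x : img i x -> tau sigma i x != 0.
Proof.
move=> ix; rewrite tauE mulf_neq0 //; first by rewrite gt_eqF ?epsilon_norm_gt0.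
by have := sigma_unitmx ix; rewrite unitmxE unitfE.
Qed.

(* The 1-form relating [G] to the Levi-Civita connection of the metric. *)
Definition upsilon i x : 'cV[R]_n := invmx (sigma i x) *m \col_b mu i x b.

Definition ghat : christoffels A := fun i x c a b =>
  G i x c a b + kron R c b * upsilon i x a 0 + kron R c a * upsilon i x b 0.

Definition ghat_mx i x a : 'M[R]_n := \matrix_(b, d) ghat i x b a d.

Lemma sigma_upsilon i x : img i x -> sigma i x *m upsilon i x = \col_b mu i x b.
Proof. by move=> ix; rewrite /upsilon mulKVmx // sigma_unitmx. Qed.

Lemma muE i x b : img i x -> mu i x b = \sum_c sigma i x b c * upsilon i x c 0.
Proof. by move=> /sigma_upsilon/matrixP/(_ b 0); rewrite !mxE. Qed.

(** By the metricity equation nabla sigma is a pure trace; symmetry of sigma identifies its two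
    traces, and [L_mu] is -1/(n+1) times that trace. So the first component of the derivative of
    [L sigma] vanishes. *)
Lemma metricity_nabla2 i x a b c : img i x ->
  nabla2 G (-2) sigma i x a b c = - (kron R a b * mu i x c + kron R a c * mu i x b).
Proof.
move=> ix; have := sigma_metricity ix a b c.
rewrite /metricity_op /trace_free_part => /eqP; rewrite subr_eq0 => /eqP ->.
have -> : \sum_d nabla2 G (-2) sigma i x d b d = \sum_d nabla2 G (-2) sigma i x d d b.
  apply: eq_bigr => d _; rewrite /nabla2 [sigma i x b d]sigma_symE //.
  congr (_ + _); rewrite addrAC; congr (_ + _ + _).
  - by apply: (partial_eq _ (open_img i) ix) => y iy; rewrite sigma_symE.
  - by apply: eq_bigr => e _; rewrite [sigma i x b e]sigma_symE.
  - by apply: eq_bigr => e _; rewrite [sigma i x e d]sigma_symE.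
rewrite /mu /L_mu; ring.
Qed.

(** This is 2/(n+1) times the trace of [ghat], the negative of the term by which [ghat] acts on the
    weight -2. *)
Let cof i x a := 2 * upsilon i x a 0 + 2 / n.+1%:R * t i x a.

(** Sigma, with its weight, is parallel for [ghat]: the terms delta_a^b mu^c that [ghat] adds
    through sigma Upsilon = mu cancel the pure trace nabla sigma. *)
Lemma dsigma i x a : img i x ->
  dmx a (sigma i) x = cof i x a *: sigma i x
    - (ghat_mx i x a *m sigma i x + sigma i x *m (ghat_mx i x a)^T).
Proof.
move=> ix; apply/matrixP => b c; rewrite !mxE.
have := metricity_nabla2 a b c ix; rewrite /nabla2 /weight_term -/t.
set p := partial _ _ _ => e.
have -> : \sum_d ghat_mx i x a b d * sigma i x d c =
    \sum_d G i x b a d * sigma i x d c + upsilon i x a 0 * sigma i x b c + kron R a b * mu i x c.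
  rewrite muE // big_distrr /= -(kron_sum b (fun d => upsilon i x a 0 * sigma i x d c)).
  rewrite -!big_split /=; apply: eq_bigr => d _.
  by rewrite mxE /ghat (sigma_symE c) // (kronC R a b); ring.
have -> : \sum_d sigma i x b d * (ghat_mx i x a)^T d c =
    \sum_d G i x c a d * sigma i x b d + upsilon i x a 0 * sigma i x b c + kron R a c * mu i x b.
  rewrite muE // big_distrr /= -(kron_sum c (fun d => upsilon i x a 0 * sigma i x b d)).
  rewrite -!big_split /=; apply: eq_bigr => d _.
  by rewrite mxE mxE /ghat (kronC R a c); ring.
move: e; rewrite /cof; set s1 := \sum_d _; set s2 := \sum_d _ => e.
have -> : p = - (kron R a b * mu i x c + kron R a c * mu i x b) - s1 - s2
   - (-2 / n.+1%:R * t i x a * sigma i x b c) by rewrite -e; ring.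
ring.
Qed.

Lemma trace_ghat_mx i x a : \tr (ghat_mx i x a) = t i x a + n.+1%:R * upsilon i x a 0.
Proof.
rewrite /mxtrace /t /christoffel_trace; under eq_bigr do rewrite mxE.
rewrite !big_split /= -addrA; congr (_ + _); rewrite sum_kron.
under eq_bigr do rewrite /kron eqxx mul1r.
by rewrite sumr_const card_ord -[_ *+ n]mulr_natl; ring.
Qed.

Lemma sigma_differentiable i x b c : img i x -> differentiable (fun y => sigma i y b c) x.
Proof. exact: smooth_differentiable (bivec_smooth sigma i b c). Qed.

Lemma det_sigma_smooth i : smooth_on (img i) (fun y => \det (sigma i y)).
Proof. by apply: (smooth_det (open_img i)) => b c; exact: bivec_smooth. Qed.

Lemma tau_smooth i : smooth_on (img i) (tau sigma i).
Proof.
apply: (smooth_eq (open_img i) _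
  (smoothM (open_img i) (smooth_cst (open_img i) (epsilon_norm (R := R) (n := n)))
     (@det_sigma_smooth i))) => x _.
by rewrite tauE.
Qed.

(** Jacobi's formula gives the logarithmic derivative n cof - 2 tr(ghat), and 2 tr(ghat) = (n+1)
    cof. So tau, of weight 2, is parallel for [ghat]. *)
Lemma partial_tau i x a : img i x -> partial a (tau sigma i) x = - tau sigma i x * cof i x a.
Proof.
move=> ix; have us := sigma_unitmx ix.
rewrite (@partial_eq _ _ (img i) _ (fun y => epsilon_norm (R := R) (n := n) * \det (sigma i y))) //;
  [|exact: open_img|by move=> y _; rewrite tauE].
rewrite partialZ; last exact: smooth_differentiable (@det_sigma_smooth i) ix.
rewrite partial_det // => [|b c]; last exact: sigma_differentiable.
rewrite mulrA -tauE mulNr -mulrN; congr (_ * _).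
rewrite dsigma // mulmxBl mulmxDl -scalemxAl mulmxV // mulmxK //.
rewrite linearB linearD linearZ /= mxtrace1 mxtrace_mulC mulmxA mulVmx // mul1mx mxtrace_tr.
rewrite trace_ghat_mx /cof -natr1.
have : n%:R + 1 != 0 :> R by rewrite natr1 pnatr_eq0.
by move=> ?; field.
Qed.

Definition inverse_metric i x : 'M[R]_n := tau sigma i x *: sigma i x.

Lemma inverse_metric_unitmx i x : img i x -> inverse_metric i x \in unitmx.
Proof.
move=> ix; rewrite /inverse_metric unitmxZ ?sigma_unitmx //.
by rewrite unitfE tau_neq0.
Qed.

Lemma inverse_metric_smooth i b c : smooth_on (img i) (fun x => inverse_metric i x b c).
Proof.
apply: (smooth_eq (open_img i) _
  (smoothM (open_img i) (@tau_smooth i) (bivec_smooth sigma i b c))) => x _.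
by rewrite mxE.
Qed.

(** The weights of tau and sigma are opposite, so the [cof] terms cancel. *)
Lemma d_inverse_metric i x a : img i x ->
  dmx a (inverse_metric i) x =
  - (ghat_mx i x a *m inverse_metric i x + inverse_metric i x *m (ghat_mx i x a)^T).
Proof.
move=> ix; rewrite dmxZ; last by move=> b c; exact: sigma_differentiable.
  rewrite partial_tau // dsigma // /inverse_metric -scalemxAr -scalemxAl -scalerDr.
  by rewrite scalerBr scalerA mulNr scaleNr addrA addNr add0r.
exact: smooth_differentiable (@tau_smooth i) ix.
Qed.

Lemma d_metric i x a : img i x ->
  dmx a (metric_of sigma i) x =
  metric_of sigma i x *m ghat_mx i x a + (ghat_mx i x a)^T *m metric_of sigma i x.
Proof.
move=> ix; have uh := inverse_metric_unitmx ix.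
rewrite (dmx_inv a (open_img i) ix (@inverse_metric_smooth i)) //; last first.
  by move=> y; exact: inverse_metric_unitmx.
rewrite d_inverse_metric // mulmxN mulNmx opprK mulmxDr mulmxDl.
by rewrite mulmxA (mulmxK uh) (mulKmx uh).
Qed.

Lemma metric_of_sym i x b c : img i x -> metric_of sigma i x b c = metric_of sigma i x c b.
Proof.
move=> ix; rewrite -[in LHS](trmxK (metric_of sigma i x)) mxE /metric_of trmx_inv.
by rewrite linearZ /= bivec_sym.
Qed.

Lemma ghat_sym i x c a b : img i x -> ghat i x c a b = ghat i x c b a.
Proof. by move=> ix; rewrite /ghat G_torsion_free // addrAC. Qed.

(** [ghat] is symmetric and preserves the metric by [d_metric]; the Koszul formula recovers any such
    connection. *)
Lemma levi_civita_ghat i x c a b : img i x ->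
  levi_civita (metric_of sigma) i x c a b = ghat i x c a b.
Proof.
move=> ix; rewrite /levi_civita /metric_of invmxK -/(metric_of sigma) -/(inverse_metric i x).
have dg e f h : partial e (fun y => metric_of sigma i y f h) x =
    \sum_k (metric_of sigma i x f k * ghat i x k e h + ghat i x k e f * metric_of sigma i x k h).
  have /matrixP/(_ f h) := d_metric e ix; rewrite mxE => ->.
  by rewrite !mxE -big_split; apply: eq_bigr => k _; rewrite !mxE.
transitivity (\sum_d \sum_k inverse_metric i x c d * metric_of sigma i x d k * ghat i x k a b).
  rewrite big_distrr /=; apply: eq_bigr => d _; rewrite -[metric_of _]/(metric_of sigma) !dg.
  rewrite -big_split -sumrB !big_distrr /=; apply: eq_bigr => k _.
  rewrite (ghat_sym k d a) // (ghat_sym k d b) // (ghat_sym k b a) //.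
  by rewrite (metric_of_sym b) // (metric_of_sym d) //; field.
rewrite exchange_big /= -[RHS](kron_sum c (fun k => ghat i x k a b)).
apply: eq_bigr => k _; rewrite -big_distrl /=; congr (_ * _).
have /matrixP/(_ c k) := mulmxV (inverse_metric_unitmx ix).
by rewrite !mxE.
Qed.

Lemma christoffel_trace_smooth i a : smooth_on (img i) (fun x => t i x a).
Proof. by apply: (smooth_sum (open_img i)) => d _; exact: G_smooth. Qed.

Lemma mu_smooth i b : smooth_on (img i) (fun x => mu i x b).
Proof.
have oi := open_img i.
apply: smoothZ => //; apply: smooth_sum => // a _; apply: smoothD => //; last first.
  apply: smoothM => //; last exact: bivec_smooth.
  by apply: smoothZ => //; exact: christoffel_trace_smooth.
do 2![apply: smoothD => //; last by apply: smooth_sum => // d _; apply: smoothM => //; exact: bivec_smooth].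
exact: smooth_derive (bivec_smooth sigma i a b).
Qed.

Lemma upsilon_smooth i a : smooth_on (img i) (fun x => upsilon i x a 0).
Proof.
have oi := open_img i.
apply: (smooth_eq oi (f := fun x => \sum_b invmx (sigma i x) a b * mu i x b)) => [x _|].
  by rewrite mxE; apply: eq_bigr => b _; rewrite mxE.
apply: smooth_sum => // b _; apply: smoothM => //; last exact: mu_smooth.
apply: smooth_invmx => // [x|c d]; [exact: sigma_unitmx|exact: bivec_smooth].
Qed.

Lemma ghat_smooth i c a b : smooth_on (img i) (fun x => ghat i x c a b).
Proof.
have oi := open_img i.
apply: smoothD => //; last by apply: smoothZ => //; exact: upsilon_smooth.
by apply: smoothD => //; apply: smoothZ => //; exact: upsilon_smooth.
Qed.

Lemma curvature_smooth (H : christoffels A) i a b c d :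
  (forall i c a b, smooth_on (img i) (fun x => H i x c a b)) ->
  smooth_on (img i) (fun x => curvature H i x a b c d).
Proof.
move=> sH; have oi := open_img i; apply: smoothD => //.
  by apply: smoothB => //; apply: smooth_derive; exact: sH.
by apply: smooth_sum => // e _; apply: smoothB => //; apply: smoothM.
Qed.

Lemma schouten_smooth i a b : smooth_on (img i) (fun x => P i x a b).
Proof.
have oi := open_img i; apply: smoothM => //; first exact: smooth_cst.
by apply: smooth_sum => // c _; exact: curvature_smooth.
Qed.

Lemma rho_smooth i : smooth_on (img i) (rho i).
Proof.
have oi := open_img i.
apply: smoothZ => //; apply: smoothB => //; apply: smooth_sum => // a _; last first.
  apply: smooth_sum => // b _; apply: smoothM => //; [exact: schouten_smooth|exact: bivec_smooth].
apply: smoothD => //; last first.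
  apply: smoothM => //; last exact: mu_smooth.
  by apply: smoothZ => //; exact: christoffel_trace_smooth.
apply: smoothD => //; first by apply: smooth_derive; exact: mu_smooth.
by apply: smooth_sum => // d _; apply: smoothM => //; exact: mu_smooth.
Qed.

(* The last slot of [L sigma] in the splitting of the Levi-Civita connection. *)
Definition rho_hat i x : R := rho i x - \sum_c upsilon i x c 0 * mu i x c.

(** The lambda of the overview. It is defined chart by chart; agreement on overlaps is obtained only
    where the second tractor component vanishes. *)
Definition einstein_factor i x : R := tau sigma i x * rho_hat i x.

Lemma einstein_factor_smooth i : smooth_on (img i) (einstein_factor i).
Proof.
have oi := open_img i; apply: smoothM => //; first exact: tau_smooth.
apply: smoothB => //; first exact: rho_smooth.
by apply: smooth_sum => // c _; apply: smoothM => //; [exact: upsilon_smooth|exact: mu_smooth].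
Qed.

(** * Closedness of Upsilon, the Ricci tensor of [ghat], and the second and third tractor
    components *)

Section Closed.
Variable omega : chart A -> 'rV[R]_n -> R.
Hypothesis omega_volume : volume_form omega.
Hypothesis omega_parallel : forall i x, img i x -> forall a,
  partial a (omega i) x - t i x a * omega i x = 0.

(** The logarithmic derivatives of tau and omega are -2 Upsilon - 2t/(n+1) and t; this combination
    eliminates t. *)
Lemma upsilon_log i x a : img i x ->
  upsilon i x a 0 = - (2^-1 * (partial a (tau sigma i) x / tau sigma i x)
    + n.+1%:R^-1 * (partial a (omega i) x / omega i x)).
Proof.
move=> ix; have /eqP := omega_parallel ix a; rewrite subr_eq0 => /eqP ->.
rewrite partial_tau // mulNr !mulNr -[_ * cof _ _ _]mulrC !mulfK ?tau_neq0 //;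
  last exact: (volume_neq0 omega_volume).
rewrite /cof -natr1; have : n%:R + 1 != 0 :> R by rewrite natr1 pnatr_eq0.
by move=> ?; field.
Qed.

Lemma upsilon_closed i x a b : img i x ->
  partial b (fun y => upsilon i y a 0) x = partial a (fun y => upsilon i y b 0) x.
Proof.
move=> ix; have oi := open_img i.
have s_tau := @tau_smooth i; have s_omega := volume_smooth omega_volume i.
have n_tau y := @tau_neq0 i y; have n_omega y := volume_neq0 omega_volume (i := i) (x := y).
have E c d : partial c (fun y => upsilon i y d 0) x =
    - (2^-1 * partial c (fun y => partial d (tau sigma i) y / tau sigma i y) x
       + n.+1%:R^-1 * partial c (fun y => partial d (omega i) y / omega i y) x).
  rewrite (partial_eq c oi ix (@upsilon_log i ^~ d)).
  have d1 f : smooth_on (img i) f -> (forall y, img i y -> f y != 0) ->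
      differentiable (fun y => partial d f y / f y) x.
    move=> sf nf; apply: differentiableM.
      exact: smooth_differentiable (smooth_derive _ sf) ix.
    by apply: differentiableV; [exact: smooth_differentiable ix|exact: nf].
  rewrite partialN; last by apply: differentiableD; apply: differentiable_mull; exact: d1.
  rewrite partialD; try by apply: differentiable_mull; exact: d1.
  by rewrite !partialZ //; exact: d1.
by rewrite !E !(partial_log_comm (U := img i) a b).
Qed.

Definition dupsilon i x a c : R :=
  partial a (fun y => upsilon i y c 0) x - \sum_d G i x d a c * upsilon i x d 0.

(** The projective change formula is taken as the definition; [ricci_ghat] shows that (n-1) times it
    is the Ricci tensor of [ghat]. *)
Definition schouten_hat i x a c : R :=
  P i x a c - dupsilon i x a c + upsilon i x a 0 * upsilon i x c 0.

Let U i x a := upsilon i x a 0.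

Lemma upsilon_differentiable i x a : img i x -> differentiable (fun y => U i y a) x.
Proof. exact: smooth_differentiable (@upsilon_smooth i a). Qed.

Lemma partial_ghat i x e c a b : img i x ->
  partial e (fun y => ghat i y c a b) x = partial e (fun y => G i y c a b) x
    + kron R c b * partial e (fun y => U i y a) x + kron R c a * partial e (fun y => U i y b) x.
Proof.
move=> ix; have dU k := upsilon_differentiable k ix.
have dG := smooth_differentiable (G_smooth i c a b) ix.
have d1 := differentiable_mull (kron R c b) (dU a).
have d2 := differentiable_mull (kron R c a) (dU b).
rewrite /ghat partialD ?partialD ?partialZ //; try exact: dU.
exact: differentiableD dG d1.
Qed.

Lemma G_trace i x e : img i x -> \sum_c G i x c c e = t i x e.
Proof. by move=> ix; apply: eq_bigr => c _; rewrite G_torsion_free. Qed.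

(** The terms in t cancel between the two products. The coefficient of Gamma Upsilon is (n+1) - 2,
    that of Upsilon Upsilon is 2(n+1) - (n+3); both equal n-1. *)
Lemma ricci_ghat_quadratic i x a b : img i x ->
  \sum_c \sum_e (ghat i x c c e * ghat i x e a b - ghat i x c a e * ghat i x e c b) =
  \sum_c \sum_e (G i x c c e * G i x e a b - G i x c a e * G i x e c b)
  + (n%:R - 1) * (\sum_d G i x d a b * U i x d + U i x a * U i x b).
Proof.
move=> ix; have sumE (F H : 'I_n -> 'I_n -> R) :
    \sum_c \sum_e (F c e - H c e) = \sum_e \sum_c F c e - \sum_c \sum_e H c e.
  rewrite [X in _ = X - _]exchange_big -sumrB; apply: eq_bigr => c _.
  by rewrite sumrB.
rewrite 2!sumE.
have -> : \sum_e \sum_c ghat i x c c e * ghat i x e a b =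
    \sum_e \sum_c G i x c c e * G i x e a b
    + n.+1%:R * \sum_d G i x d a b * U i x d
    + (t i x b + n.+1%:R * U i x b) * U i x a + (t i x a + n.+1%:R * U i x a) * U i x b.
  rewrite -(sum_kron b (fun e => (t i x e + n.+1%:R * U i x e) * U i x a)).
  rewrite -(sum_kron a (fun e => (t i x e + n.+1%:R * U i x e) * U i x b)).
  rewrite big_distrr -!big_split /=; apply: eq_bigr => e _.
  rewrite -!big_distrl /= G_trace //.
  have -> : \sum_c ghat i x c c e = t i x e + n.+1%:R * U i x e.
    rewrite -G_trace // !big_split /= -addrA; congr (_ + _); rewrite sum_kron.
    under eq_bigr do rewrite /kron eqxx mul1r.
    by rewrite sumr_const card_ord -[_ *+ n]mulr_natl -natr1 /U; ring.
  by rewrite /ghat -/(U i x a) -/(U i x b); ring.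
have -> : \sum_c \sum_e ghat i x c a e * ghat i x e c b =
    \sum_c \sum_e G i x c a e * G i x e c b
    + 2 * (\sum_d G i x d a b * U i x d) + t i x a * U i x b + t i x b * U i x a
    + n%:R * U i x a * U i x b + 3 * (U i x a * U i x b).
  transitivity (\sum_c (\sum_e G i x c a e * G i x e c b + G i x c a b * U i x c
    + G i x c a c * U i x b + G i x c c b * U i x a + U i x a * U i x b
    + kron R c b * (U i x a * U i x c)
    + kron R c a * (\sum_e G i x e c b * U i x e + 2 * U i x c * U i x b))).
    apply: eq_bigr => c _.
    rewrite -(kron_sum b (fun e => G i x c a e * U i x c)).
    rewrite -(kron_sum c (fun e => G i x c a e * U i x b)).
    rewrite -(kron_sum c (fun e => G i x e c b * U i x a)).
    (* The product of the two [ghat] contains a squared Kronecker symbol, so this term is rewritten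
       in that form to make the summands match under [ring]. *)
    have -> : U i x a * U i x b =
        \sum_e kron R c e * (kron R c e * (U i x a * U i x b)).
      by rewrite kron_sum {1}/kron eqxx mul1r.
    have -> : kron R c b * (U i x a * U i x c) =
        \sum_e kron R c e * (kron R e b * (U i x a * U i x c)).
      by rewrite kron_sum.
    have -> : 2 * U i x c * U i x b =
        \sum_e (kron R b e * (U i x e * U i x c) + kron R c e * (U i x b * U i x e)).
      by rewrite big_split /= !kron_sum; ring.
    rewrite mulrDr !big_distrr -!big_split /=; apply: eq_bigr => e _.
    by rewrite /ghat -!/(U i x _) (kronC R e c) (kronC R e b); ring.
  rewrite !big_split /= !sum_kron -!big_distrl /= G_trace // sumr_const card_ord.
  by rewrite -[U i x a *+ n]mulr_natl -[\sum_(e < n) G i x e a e]/(t i x a); ring.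
by rewrite -natr1; ring.
Qed.

(** The derivative terms contribute d_b Upsilon_a - n d_a Upsilon_b, which closedness turns into
    -(n-1) d_a Upsilon_b. *)
Lemma ricci_ghat i x a b : img i x ->
  ricci ghat i x a b = (n%:R - 1) * schouten_hat i x a b.
Proof.
move=> ix; have n1 : n%:R - 1 != 0 :> R.
  by rewrite subr_eq0 pnatr_eq1; case: (n) n_ge2 => [|[]].
have -> : (n%:R - 1) * schouten_hat i x a b =
    ricci G i x a b - (n%:R - 1) * (dupsilon i x a b - U i x a * U i x b).
  by rewrite /schouten_hat /P /schouten -!/(U i x _); field.
have -> : ricci G i x a b =
    \sum_c (partial c (fun y => G i y c a b) x - partial a (fun y => G i y c c b) x)
    + \sum_c \sum_e (G i x c c e * G i x e a b - G i x c a e * G i x e c b).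
  by rewrite -big_split.
have -> : ricci ghat i x a b =
    \sum_c (partial c (fun y => ghat i y c a b) x - partial a (fun y => ghat i y c c b) x)
    + \sum_c \sum_e (ghat i x c c e * ghat i x e a b - ghat i x c a e * ghat i x e c b).
  by rewrite -big_split.
rewrite ricci_ghat_quadratic //.
have -> : \sum_c (partial c (fun y => ghat i y c a b) x - partial a (fun y => ghat i y c c b) x) =
    \sum_c (partial c (fun y => G i y c a b) x - partial a (fun y => G i y c c b) x)
    - (n%:R - 1) * partial a (fun y => U i y b) x.
  transitivity (\sum_c (partial c (fun y => G i y c a b) x - partial a (fun y => G i y c c b) x
      + kron R c b * partial c (fun y => U i y a) x + kron R c a * partial c (fun y => U i y b) x
      - kron R c b * partial a (fun y => U i y c) x - partial a (fun y => U i y b) x)).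
    apply: eq_bigr => c _; rewrite !partial_ghat //.
    by rewrite (_ : kron R c c = 1); [ring|rewrite /kron eqxx].
  rewrite !big_split /= !sumrN !sum_kron sumr_const card_ord -[_ *+ n]mulr_natl.
  by rewrite (upsilon_closed a b ix) -/(U i); ring.
by rewrite /dupsilon -/(U i); ring.
Qed.

Lemma mu_differentiable i x b : img i x -> differentiable (fun y => mu i y b) x.
Proof. exact: smooth_differentiable (@mu_smooth i b). Qed.

(** Differentiate mu = sigma Upsilon with [dsigma]. Covariantly: nabla_a mu^b = sigma^bc nabla_a
    Upsilon_c - Upsilon_a mu^b - delta_a^b Upsilon_c mu^c. *)
Lemma partial_mu i x a b : img i x ->
  partial a (fun y => mu i y b) x =
  2 / n.+1%:R * t i x a * mu i x b - \sum_d G i x b a d * mu i x d - U i x a * mu i x b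
  - kron R a b * \sum_c U i x c * mu i x c + \sum_c sigma i x b c * dupsilon i x a c.
Proof.
move=> ix; have oi := open_img i.
rewrite (partial_eq a oi ix (fun y iy => muE b iy)).
rewrite partial_sum => [|c]; last first.
  apply: differentiableM; [exact: sigma_differentiable|exact: upsilon_differentiable].
have -> : \sum_c partial a (fun y => sigma i y b c * upsilon i y c 0) x =
    (dmx a (sigma i) x *m upsilon i x) b 0 + \sum_c sigma i x b c * partial a (fun y => U i y c) x.
  rewrite mxE -big_split /=; apply: eq_bigr => c _.
  rewrite partialM ?mxE //; [exact: sigma_differentiable|exact: upsilon_differentiable].
rewrite dsigma // mulmxBl mulmxDl -scalemxAl -!mulmxA sigma_upsilon //.
have -> : (cof i x a *: (\col_b0 mu i x b0) - (ghat_mx i x a *m (\col_b0 mu i x b0) +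
      sigma i x *m ((ghat_mx i x a)^T *m upsilon i x))) b 0 =
    cof i x a * mu i x b - \sum_d ghat i x b a d * mu i x d
    - \sum_c sigma i x b c * \sum_d ghat i x d a c * U i x d.
  have mE (p q : 'cV[R]_n) (B C : 'M[R]_n) : (cof i x a *: p - (B *m p + C *m (B^T *m q))) b 0 =
      cof i x a * p b 0 - \sum_d B b d * p d 0 - \sum_c C b c * \sum_d B d c * q d 0.
    rewrite !mxE opprD addrA; congr (_ - _ - _); apply: eq_bigr => c _.
    by rewrite mxE; congr (_ * _); apply: eq_bigr => d _; rewrite mxE.
  rewrite mE mxE; congr (_ - _ - _); apply: eq_bigr => c _; first by rewrite !mxE.
  by congr (_ * _); apply: eq_bigr => d _; rewrite mxE.
have -> : \sum_d ghat i x b a d * mu i x d = \sum_d G i x b a d * mu i x d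
    + U i x a * mu i x b + kron R a b * \sum_c U i x c * mu i x c.
  rewrite -(kron_sum b (fun d => U i x a * mu i x d)) big_distrr -!big_split /=.
  by apply: eq_bigr => d _; rewrite /ghat -!/(U i x _) (kronC R a b); ring.
have -> : \sum_c sigma i x b c * \sum_d ghat i x d a c * U i x d =
    \sum_c sigma i x b c * (\sum_d G i x d a c * U i x d) + 2 * U i x a * mu i x b.
  rewrite muE // big_distrr -big_split /=; apply: eq_bigr => c _.
  have -> : \sum_d ghat i x d a c * U i x d =
      \sum_d G i x d a c * U i x d + 2 * U i x a * U i x c.
    have -> : 2 * U i x a * U i x c = \sum_d (kron R c d * (U i x a * U i x d)
        + kron R a d * (U i x c * U i x d)) by rewrite big_split /= !kron_sum; ring.
    rewrite -big_split /=; apply: eq_bigr => d _.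
    by rewrite /ghat -!/(U i x _) (kronC R d c) (kronC R d a); ring.
  by rewrite -/(U i x c); ring.
have -> : \sum_c sigma i x b c * dupsilon i x a c =
    \sum_c sigma i x b c * partial a (fun y => U i y c) x
    - \sum_c sigma i x b c * (\sum_d G i x d a c * U i x d).
  by rewrite -sumrB; apply: eq_bigr => c _; rewrite /dupsilon mulrBr.
by rewrite /cof -/(U i x a); ring.
Qed.

Lemma conn2E i x a b : img i x ->
  tractor_conn2 G (L G sigma) i x a b =
  kron R a b * rho_hat i x - \sum_c schouten_hat i x a c * sigma i x b c.
Proof.
move=> ix; rewrite /tractor_conn2 /= /nabla1 /weight_term -/mu -/rho -/t -/P partial_mu //.
have -> : \sum_c schouten_hat i x a c * sigma i x b c =
    \sum_c P i x a c * sigma i x b c - \sum_c sigma i x b c * dupsilon i x a c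
    + U i x a * mu i x b.
  rewrite muE // big_distrr -sumrB -big_split /=; apply: eq_bigr => c _.
  by rewrite /schouten_hat -!/(U i x _); ring.
by rewrite /rho_hat -!/(U i x _); ring.
Qed.

(** [L sigma] trivially satisfies the right-hand side of its own characterisation. *)
Lemma conn2_trace i x : img i x -> \sum_a tractor_conn2 G (L G sigma) i x a a = 0.
Proof.
move=> ix; have n0 : (0 < n)%N by exact: leq_trans n_ge2.
have [_ h] := L_characterisation G (t := L G sigma) n0 (erefl (bivec sigma)).
exact: (h (fun i x _ => conj erefl erefl) i x ix).2.
Qed.

Lemma metric_unitmx i x : img i x -> metric_of sigma i x \in unitmx.
Proof. by move=> ix; rewrite unitmx_inv inverse_metric_unitmx. Qed.

Lemma schouten_sigmaE i x a b : \sum_c schouten_hat i x a c * sigma i x b c =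
  ((\matrix_(c, d) schouten_hat i x c d) *m (sigma i x)^T) a b.
Proof. by rewrite mxE; apply: eq_bigr => c _; rewrite !mxE. Qed.

Lemma conn2_eq0 i x : img i x -> (forall a b, tractor_conn2 G (L G sigma) i x a b = 0) ->
  forall a b, schouten_hat i x a b = einstein_factor i x * metric_of sigma i x a b.
Proof.
move=> ix h a b; pose S := \matrix_(c, d) schouten_hat i x c d.
have us := sigma_unitmx ix; have tau0 := tau_neq0 ix.
have e : S *m sigma i x = (rho_hat i x)%:M.
  apply/matrixP => c d; have := h c d; rewrite conn2E // schouten_sigmaE bivec_sym // => /eqP.
  by rewrite subr_eq0 => /eqP <-; rewrite mxE mulr_natl.
have -> : schouten_hat i x a b = S a b by rewrite mxE.
rewrite -(mulmxK us S) e mul_scalar_mx /metric_of invmxZ ?inverse_metric_unitmx //.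
by rewrite !mxE /einstein_factor mulrA; congr (_ * _); rewrite mulrAC mulfV ?mul1r.
Qed.

(** Here K may depend on the point. The second component becomes (rho^ - K/tau) times the identity,
    and it is trace-free, so the scalar vanishes and K is determined. *)
Lemma schouten_hat_proportional i x (K : R) : img i x ->
  (forall a b, schouten_hat i x a b = K * metric_of sigma i x a b) ->
  (forall a b, tractor_conn2 G (L G sigma) i x a b = 0) /\ einstein_factor i x = K.
Proof.
move=> ix h; have us := sigma_unitmx ix; have tau0 := tau_neq0 ix.
have nR : n%:R != 0 :> R by rewrite pnatr_eq0 -lt0n (leq_trans _ n_ge2).
have e a b : tractor_conn2 G (L G sigma) i x a b =
    kron R a b * (rho_hat i x - K / tau sigma i x).
  rewrite conn2E // schouten_sigmaE bivec_sym //.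
  have -> : (\matrix_(c, d) schouten_hat i x c d) = (K / tau sigma i x) *: invmx (sigma i x).
    apply/matrixP => c d; rewrite mxE h /metric_of invmxZ ?inverse_metric_unitmx //.
    by rewrite !mxE mulrA.
  by rewrite -scalemxAl mulVmx // !mxE -[(_ == _)%:R]/(kron R a b); ring.
have e0 : rho_hat i x - K / tau sigma i x = 0.
  apply: (mulfI nR); rewrite mulr0 -(conn2_trace ix).
  under eq_bigr do rewrite e /kron eqxx mul1r.
  by rewrite sumr_const card_ord mulr_natl.
split=> [a b|]; first by rewrite e e0 mulr0.
move/eqP: e0; rewrite subr_eq0 => /eqP e0.
by rewrite /einstein_factor e0 mulrC divfK.
Qed.

(** With the second component zero, sigma nabla Upsilon is known algebraically, so d(Upsilon_c mu^c)
    contains no derivative of Upsilon or mu; the terms Upsilon_a rho^ then cancel against those from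
    d tau. *)
Lemma partial_einstein_factor i x a : img i x ->
  (forall a b, tractor_conn2 G (L G sigma) i x a b = 0) ->
  partial a (einstein_factor i) x = tau sigma i x * tractor_conn3 G (L G sigma) i x a.
Proof.
move=> ix h; have oi := open_img i.
have d_tau := smooth_differentiable (@tau_smooth i) ix.
have d_rho := smooth_differentiable (@rho_smooth i) ix.
have dU c := upsilon_differentiable c ix; have dmu c := mu_differentiable c ix.
have dUmu c : differentiable (fun y => U i y c * mu i y c) x by exact: differentiableM.
have dsum : differentiable (fun y => \sum_c U i y c * mu i y c) x by exact: differentiable_bigsum.
have -> : partial a (einstein_factor i) x =
    partial a (tau sigma i) x * rho_hat i x + tau sigma i x * (partial a (rho i) x
    - \sum_c (partial a (fun y => U i y c) x * mu i x c + U i x c * partial a (fun y => mu i y c) x)).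
  rewrite partialM //; last exact: differentiableB.
  congr (_ + _ * _); rewrite partialB //; congr (_ - _).
  by rewrite partial_sum //; apply: eq_bigr => c _; exact: (partialM a (dU c) (dmu c)).
(* The vanishing second component, solved for sigma^bc nabla_a Upsilon_c. *)
have nabla_mu b : \sum_c sigma i x b c * dupsilon i x a c =
    \sum_c P i x a c * sigma i x b c + U i x a * mu i x b - kron R a b * rho_hat i x.
  have := h a b; rewrite conn2E // => /eqP; rewrite subr_eq0 => /eqP ->.
  rewrite muE // big_distrr -big_split -sumrB /=; apply: eq_bigr => c _.
  by rewrite /schouten_hat -!/(U i x _); ring.
have PmuE : \sum_c U i x c * (\sum_d P i x a d * sigma i x c d) = \sum_d P i x a d * mu i x d.
  under eq_bigr do rewrite big_distrr /=.
  rewrite exchange_big; apply: eq_bigr => d _; rewrite muE // big_distrr /=.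
  by apply: eq_bigr => c _; rewrite (sigma_symE c d) // -/(U i x c); ring.
have dUE : \sum_c dupsilon i x a c * mu i x c =
    \sum_c U i x c * (\sum_d sigma i x c d * dupsilon i x a d).
  under [RHS]eq_bigr do rewrite big_distrr /=.
  rewrite exchange_big; apply: eq_bigr => d _; rewrite muE // big_distrr /=.
  by apply: eq_bigr => c _; rewrite (sigma_symE c d) // -/(U i x c); ring.
set S := \sum_c U i x c * mu i x c.
(* Contraction of [nabla_mu] with Upsilon_b. *)
have key : \sum_c dupsilon i x a c * mu i x c =
    \sum_d P i x a d * mu i x d + U i x a * S - U i x a * rho_hat i x.
  rewrite dUE -PmuE /S big_distrr -(kron_sum a (fun c => U i x c * rho_hat i x)).
  rewrite -big_split -sumrB /=; apply: eq_bigr => c _; rewrite nabla_mu; ring.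
(* The factor 2 arises because, sigma being symmetric, both terms of the product rule yield (nabla_a
   Upsilon_c) mu^c; the Christoffel terms cancel by [GE]. *)
have -> : \sum_c (partial a (fun y => U i y c) x * mu i x c + U i x c * partial a (fun y => mu i y c) x)
    = 2 * (\sum_c dupsilon i x a c * mu i x c) + 2 / n.+1%:R * t i x a * S - 2 * U i x a * S.
  have GE : \sum_c (\sum_d G i x d a c * U i x d) * mu i x c =
      \sum_c U i x c * (\sum_d G i x c a d * mu i x d).
    under eq_bigr do rewrite big_distrl /=.
    rewrite exchange_big; apply: eq_bigr => d _; rewrite big_distrr /=.
    by apply: eq_bigr => c _; ring.
  rewrite big_split /=.
  have -> : \sum_c partial a (fun y => U i y c) x * mu i x c =
      \sum_c dupsilon i x a c * mu i x c + \sum_c (\sum_d G i x d a c * U i x d) * mu i x c.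
    by rewrite -big_split /=; apply: eq_bigr => c _; rewrite /dupsilon -/(U i x c); ring.
  have -> : \sum_c U i x c * partial a (fun y => mu i y c) x =
      2 / n.+1%:R * t i x a * S - \sum_c U i x c * (\sum_d G i x c a d * mu i x d)
      - U i x a * S - U i x a * S + \sum_c U i x c * (\sum_d sigma i x c d * dupsilon i x a d).
    transitivity (\sum_c (2 / n.+1%:R * t i x a * (U i x c * mu i x c)
      - U i x c * (\sum_d G i x c a d * mu i x d) - U i x a * (U i x c * mu i x c)
      - kron R a c * (U i x c * S) + U i x c * (\sum_d sigma i x c d * dupsilon i x a d))).
      by apply: eq_bigr => c _; rewrite partial_mu // -/S; ring.
    by rewrite !big_split /= !sumrN kron_sum -!big_distrr.
  by rewrite GE -dUE; ring.
rewrite key partial_tau // /tractor_conn3 /nabla0 /weight_term /= -/mu -/rho -/t -/P /cof -/(U i x a).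
have -> : rho i x = rho_hat i x + S by rewrite /rho_hat subrK.
ring.
Qed.

End Closed.

End Chart.

(** * Change of chart *)

Section CoordinateSmooth.
Context {R : realType} {V : normedModType R} {m : nat}.

Lemma smooth_coord (U : set V) (phi : V -> 'rV[R]_m) (b : 'I_m) : open U ->
  smooth_on U phi -> smooth_on U (fun y => phi y 0 b).
Proof.
move=> oU sphi k; elim: k phi sphi => [|k IH] phi sphi.
  move=> x Ux; apply: (@continuous_comp _ _ _ phi (fun z : 'rV[R]_m => z 0 b)).
    exact: (sphi 0).
  exact: coord_continuous.
have dphi x : U x -> differentiable phi x by exact: smooth_differentiable.
split=> [x Ux|v].
  apply: (differentiable_comp (g := fun z : 'rV[R]_m => z 0 b)); first exact: dphi.
  exact: differentiable_coord.
apply: Ck_on_eq (IH _ (smooth_derive v sphi)) => // x Ux.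
by rewrite derive_mx ?mxE //; exact: diff_derivable (dphi x Ux).
Qed.

End CoordinateSmooth.

(** Two cross derivatives of dJ = A J - J C, where K is the second derivative of J; their difference
    eliminates K. Matrix products do not commute, but once expanded the identity is linear in the
    monomials, hence [lra] on entries. *)
Lemma gauge_algebra (R : realType) n (J Ca Cb Aa Ab dCab dCba dAab dAba K : 'M[R]_n) :
  (Aa *m J - J *m Ca) *m Cb + J *m dCab = dAab *m J + Ab *m (Aa *m J - J *m Ca) - K ->
  (Ab *m J - J *m Cb) *m Ca + J *m dCba = dAba *m J + Aa *m (Ab *m J - J *m Cb) - K ->
  (dAab - dAba + (Ab *m Aa - Aa *m Ab)) *m J = J *m (dCab - dCba + (Cb *m Ca - Ca *m Cb)).
Proof.
rewrite !(mulmxDl, mulmxDr, mulmxN, mulNmx, mulmxA) => /matrixP e1 /matrixP e2.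
apply/matrixP => k l; have := e1 k l; have := e2 k l.
have D (X Y : 'M[R]_n) : (X + Y) k l = X k l + Y k l by rewrite mxE.
have N (X : 'M[R]_n) : (- X) k l = - X k l by rewrite mxE.
rewrite !(D, N); lra.
Qed.

Section Overlap.
Context {R : realType} {n : nat} {M : topologicalType} {A : smooth_atlas R n M}.
Implicit Types (i j : chart A) (x : 'rV[R]_n) (a b c d : 'I_n).

Lemma open_overlap i j : open (overlap i j).
Proof.
rewrite openE => x [ix jx]; apply: filterI; first exact: near_open (open_img i) ix.
exact: (param_continuous ix) (open_nbhs_nbhs (conj (dom_open j) jx)).
Qed.

Lemma overlap_img i j x : overlap i j x -> img i x.
Proof. by case. Qed.

Lemma trans_img i j x : overlap i j x -> img j (trans i j x).
Proof. by case=> _ jx; exists (param i x). Qed.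

Lemma trans_differentiable i j x : overlap i j x -> differentiable (trans i j) x.
Proof. exact: smooth_differentiable (trans_smooth i j). Qed.

Lemma trans_coord_smooth i j b : smooth_on (overlap i j) (fun y => trans i j y 0 b).
Proof. exact: smooth_coord (@open_overlap i j) (trans_smooth i j). Qed.

Lemma jac_smooth i j a b : smooth_on (overlap i j) (fun y => jac i j y a b).
Proof.
apply: (smooth_eq (@open_overlap i j) _ (smooth_derive 'e_a (@trans_coord_smooth i j b))) => x _.
by rewrite mxE.
Qed.

Lemma jac_differentiable i j x a b : overlap i j x -> differentiable (fun y => jac i j y a b) x.
Proof. exact: smooth_differentiable (@jac_smooth i j a b). Qed.

Lemma partial_jac i j x a b c :
  partial a (fun y => jac i j y b c) x = partial a (partial b (fun y => trans i j y 0 c)) x.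
Proof. by congr (partial a _ x); apply/funext => y; rewrite mxE. Qed.

Lemma partial_jac_sym i j x a b c : overlap i j x ->
  partial a (fun y => jac i j y b c) x = partial b (fun y => jac i j y a c) x.
Proof.
move=> ijx; rewrite !partial_jac.
exact: partial_comm (@open_overlap i j) (@trans_coord_smooth i j c) ijx.
Qed.

Lemma partial_trans i j x a (f : 'rV[R]_n -> R) : overlap i j x ->
  differentiable f (trans i j x) ->
  partial a (fun y => f (trans i j y)) x = \sum_b jac i j x a b * partial b f (trans i j x).
Proof.
move=> ijx df; rewrite partial_comp //; last exact: trans_differentiable.
by apply: eq_bigr => b _; rewrite mxE.
Qed.

(** The law of a nowhere vanishing n-form has det J as a factor, which spares differentiating the
    inverse change of coordinates. *)
Lemma jac_unitmx (omega : chart A -> 'rV[R]_n -> R) i j x : volume_form omega ->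
  overlap i j x -> jac i j x \in unitmx.
Proof.
move=> vol ijx; have := volume_neq0 vol (overlap_img ijx).
by rewrite (volume_law vol ijx) mulf_eq0 negb_or unitmxE unitfE => /andP[].
Qed.

(** The law of [affine_connection] as a predicate, so that it can be stated for [ghat], a bare
    family of symbols. *)
Definition christoffel_law (H : christoffels A) := forall i j x, overlap i j x -> forall k a b,
  \sum_c \sum_d jac i j x a c * jac i j x b d * H j (trans i j x) k c d =
  \sum_c jac i j x c k * H i x c a b - partial a (partial b (fun y => trans i j y 0 k)) x.

(** * Tensoriality of the curvature and of the Ricci tensor *)

Section Curvature.
Variable H : christoffels A.
Hypothesis H_smooth : forall i c a b, smooth_on (img i) (fun x => H i x c a b).
Hypothesis H_law : christoffel_law H.

(** Rows carry the lower index and columns the upper one, as in [jac]; this reverses the products in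
    [curvature_mx]. *)
Definition conn_mx i a x : 'M[R]_n := \matrix_(b, k) H i x k a b.

Definition curvature_mx i x a b : 'M[R]_n :=
  dmx a (conn_mx i b) x - dmx b (conn_mx i a) x
  + (conn_mx i b x *m conn_mx i a x - conn_mx i a x *m conn_mx i b x).

Lemma curvature_mxE i x a b c d : curvature H i x a b c d = curvature_mx i x a b d c.
Proof.
rewrite !mxE /curvature; congr (_ - _ + _).
- by congr (partial a _ x); apply/funext => y; rewrite mxE.
- by congr (partial b _ x); apply/funext => y; rewrite mxE.
- by rewrite -sumrB; apply: eq_bigr => e _; rewrite !mxE; ring.
Qed.

Lemma conn_mx_differentiable i a x b c : img i x -> differentiable (fun y => conn_mx i a y b c) x.
Proof.
move=> ix; rewrite (_ : (fun y => _) = fun y => H i y c a b).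
  exact: smooth_differentiable (H_smooth i c a b) ix.
by apply/funext => y; rewrite mxE.
Qed.

Section Transition.
Variables (i j : chart A).

(** The dx^a coefficient of the connection form of the chart j, pulled back by the transition
    map. *)
Definition pullback_mx a x : 'M[R]_n :=
  \sum_c jac i j x a c *: conn_mx j c (trans i j x).

Lemma gauge_law x a : overlap i j x ->
  jac i j x *m pullback_mx a x = conn_mx i a x *m jac i j x - dmx a (jac i j) x.
Proof.
move=> ijx; apply/matrixP => b k; rewrite !mxE partial_jac.
have -> : \sum_c conn_mx i a x b c * jac i j x c k = \sum_c jac i j x c k * H i x c a b.
  by apply: eq_bigr => c _; rewrite mxE mulrC.
rewrite -(H_law ijx) exchange_big /=; apply: eq_bigr => d _.
rewrite summxE big_distrr; apply: eq_bigr => c _.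
have -> : (jac i j x a c *: conn_mx j c (trans i j x)) d k =
    jac i j x a c * H j (trans i j x) k c d by rewrite mxE; congr (_ * _); rewrite mxE.
by rewrite /= mulrA [jac i j x b d * _]mulrC.
Qed.

Lemma conn_trans_differentiable x c d k : overlap i j x ->
  differentiable (fun y => conn_mx j c (trans i j y) d k) x.
Proof.
move=> ijx; apply: (differentiable_comp (g := fun z => conn_mx j c z d k)).
  exact: trans_differentiable.
exact: conn_mx_differentiable (trans_img ijx).
Qed.

Lemma pullback_differentiable x a b c : overlap i j x ->
  differentiable (fun y => pullback_mx a y b c) x.
Proof.
move=> ijx; rewrite (_ : (fun y => _) =
    fun y => \sum_d jac i j y a d * conn_mx j d (trans i j y) b c).
  apply: differentiable_bigsum => d; apply: differentiableM.
    exact: jac_differentiable.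
  exact: conn_trans_differentiable.
by apply/funext => y; rewrite summxE; apply: eq_bigr => d _; rewrite mxE.
Qed.

Lemma d_pullback x a b : overlap i j x ->
  dmx a (pullback_mx b) x =
  \sum_d (partial a (fun y => jac i j y b d) x *: conn_mx j d (trans i j x)) +
  \sum_c \sum_d (jac i j x a c * jac i j x b d) *: dmx c (conn_mx j d) (trans i j x).
Proof.
move=> ijx; apply/matrixP => k l; rewrite mxE.
rewrite (_ : (fun y => _) = fun y => \sum_d jac i j y b d * conn_mx j d (trans i j y) k l);
  last by apply/funext => y; rewrite summxE; apply: eq_bigr => d _; rewrite mxE.
have dj d := jac_differentiable b d ijx; have dc d := conn_trans_differentiable d k l ijx.
rewrite partial_sum => [|d]; last exact: differentiableM.
rewrite exchange_big -big_split summxE /=; apply: eq_bigr => d _.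
rewrite partialM // !mxE; congr (_ + _).
rewrite (@partial_trans i j x a (fun z => conn_mx j d z k l)) //; last first.
  exact: conn_mx_differentiable (trans_img ijx).
by rewrite summxE big_distrr /=; apply: eq_bigr => c _; rewrite !mxE; ring.
Qed.

Lemma pullback_curvature x a b : overlap i j x ->
  dmx a (pullback_mx b) x - dmx b (pullback_mx a) x
  + (pullback_mx b x *m pullback_mx a x - pullback_mx a x *m pullback_mx b x) =
  \sum_c jac i j x a c *: \sum_d jac i j x b d *: curvature_mx j (trans i j x) c d.
Proof.
move=> ijx; rewrite !d_pullback //.
(* The second derivatives of the transition map are symmetric in a and b, so they drop out of the
   antisymmetrised expression. *)
under [X in _ - (X + _)]eq_bigr do rewrite (partial_jac_sym b a) //.
rewrite opprD [X in X + _]addrACA subrr add0r [X in _ - X + _]exchange_big /=.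
have mE (p q : 'I_n) : pullback_mx p x *m pullback_mx q x =
    \sum_c \sum_d (jac i j x p c * jac i j x q d) *:
      (conn_mx j c (trans i j x) *m conn_mx j d (trans i j x)).
  rewrite /pullback_mx mulmx_suml; apply: eq_bigr => c _; rewrite mulmx_sumr.
  by apply: eq_bigr => d _; rewrite -scalemxAl -scalemxAr scalerA.
rewrite !mE [X in _ + (X - _)]exchange_big -!sumrB -big_split /=; apply: eq_bigr => c _.
rewrite -!sumrB -big_split scaler_sumr /=; apply: eq_bigr => d _.
rewrite scalerA /curvature_mx !scalerDr !scalerN.
by rewrite ![jac i j x b d * _]mulrC.
Qed.

(** Equality of the mixed derivatives of the Jacobian is the integrability condition of the gauge
    law; it says that the two curvatures are conjugate by the Jacobian. *)
Lemma curvature_mx_law x a b : overlap i j x ->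
  curvature_mx i x a b *m jac i j x =
  jac i j x *m (\sum_c jac i j x a c *: \sum_d jac i j x b d *: curvature_mx j (trans i j x) c d).
Proof.
move=> ijx; rewrite -pullback_curvature //; have ix := overlap_img ijx.
have oij := @open_overlap i j.
have e1 p : dmx p (jac i j) x = conn_mx i p x *m jac i j x - jac i j x *m pullback_mx p x.
  by rewrite gauge_law // opprB addrC subrK.
have e2 p q : dmx p (jac i j) x *m pullback_mx q x + jac i j x *m dmx p (pullback_mx q) x =
    dmx p (conn_mx i q) x *m jac i j x + conn_mx i q x *m dmx p (jac i j) x
    - dmx p (dmx q (jac i j)) x.
  have dJ k l := jac_differentiable k l ijx.
  have dC k l := pullback_differentiable q k l ijx.
  have dA k l := conn_mx_differentiable q k l ix.
  rewrite -!dmxM //; apply/matrixP => k l; rewrite !mxE.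
  rewrite (partial_eq p oij ijx (f := fun y => (jac i j y *m pullback_mx q y) k l)
    (g := fun y => (conn_mx i q y *m jac i j y) k l - dmx q (jac i j) y k l)); last first.
    by move=> y ijy; rewrite gauge_law // !mxE.
  rewrite partialB //.
    rewrite (_ : (fun y => _) = fun y => \sum_m conn_mx i q y k m * jac i j y m l).
      by apply: differentiable_bigsum => m; apply: differentiableM.
    by apply/funext => y; rewrite mxE.
  rewrite (_ : (fun y => _) = partial q (fun y => jac i j y k l)).
    exact: smooth_differentiable (smooth_derive 'e_q (@jac_smooth i j k l)) ijx.
  by apply/funext => y; rewrite mxE.
have e3 : dmx a (dmx b (jac i j)) x = dmx b (dmx a (jac i j)) x.
  apply/matrixP => k l; rewrite [LHS]mxE [RHS]mxE.
  have E p q : partial p (fun y => dmx q (jac i j) y k l) x =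
      partial p (partial q (fun y => jac i j y k l)) x.
    by congr (partial p _ x); apply/funext => y; rewrite mxE.
  by rewrite !E; exact: partial_comm oij (@jac_smooth i j k l) ijx.
have := e2 a b; have := e2 b a; rewrite e3 !e1 /curvature_mx.
move=> eba eab; exact: gauge_algebra eab eba.
Qed.

End Transition.

Lemma ricci_law i j x a b : overlap i j x -> jac i j x \in unitmx ->
  ricci H i x a b =
  \sum_c \sum_d jac i j x a c * jac i j x b d * ricci H j (trans i j x) c d.
Proof.
move=> ijx uJ; set J := jac i j x; set y := trans i j x.
(* The curvature in the chart j with its second slot already contracted with row a of the Jacobian;
   only the conjugation and the trace remain. *)
pose E d : 'M[R]_n := \sum_e J a e *: curvature_mx j y d e.
have curvE c : curvature_mx i x c a = \sum_d J c d *: (J *m E d *m invmx J).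
  rewrite -(mulmxK uJ (curvature_mx i x c a)) curvature_mx_law // mulmx_sumr mulmx_suml.
  by apply: eq_bigr => d _; rewrite -scalemxAr -scalemxAl.
transitivity (\sum_d (J *m E d) b d).
  rewrite /ricci; under eq_bigr do rewrite curvature_mxE curvE summxE.
  rewrite exchange_big; apply: eq_bigr => d _ /=.
  rewrite -[in RHS](mulmxKV uJ (J *m E d)) [RHS]mxE.
  by apply: eq_bigr => c _; rewrite [LHS]mxE mulrC.
transitivity (\sum_d \sum_k \sum_e J b k * (J a e * curvature_mx j y d e k d)).
  apply: eq_bigr => d _; rewrite mxE; apply: eq_bigr => k _.
  by rewrite summxE big_distrr; apply: eq_bigr => e _ /=; rewrite [X in _ * X]mxE.
rewrite exchange_big [RHS]exchange_big; apply: eq_bigr => k _ /=.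
rewrite exchange_big; apply: eq_bigr => e _ /=.
by rewrite /ricci big_distrr; apply: eq_bigr => d _ /=; rewrite curvature_mxE; ring.
Qed.

End Curvature.

(** * Change of chart for the metric, Upsilon, [ghat] and lambda *)

Section Solution.
Variables (G : affine_connection A) (sigma : S2TM A (-2)) (omega : chart A -> 'rV[R]_n -> R).
Hypothesis n_ge2 : (2 <= n)%N.
Hypothesis G_torsion_free : torsion_free G.
Hypothesis sigma_nondegenerate : nondegenerate_section sigma.
Hypothesis sigma_metricity : forall i x, img i x -> forall a b c,
  metricity_op G sigma i x a b c = 0.
Hypothesis omega_volume : volume_form omega.
Hypothesis omega_parallel : forall i x, img i x -> forall a,
  partial a (omega i) x - christoffel_trace G i x a * omega i x = 0.

Let wf := @weight_factor R n M A (-2).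

(** The power n+1 clears the real exponent -2/(n+1) of |det J|. *)
Lemma weight_factorX i j x : overlap i j x ->
  wf i j x ^+ n.+1 * \det (jac i j x) ^+ 2 = 1.
Proof.
move=> ijx; have := jac_unitmx omega_volume ijx; rewrite unitmxE unitfE => d0.
rewrite /wf /weight_factor -powR_mulrn ?powR_ge0 // -powRrM.
rewrite divfK ?pnatr_eq0 // powRN powR_mulrn // real_normK ?num_real //.
by rewrite mulVf // expf_neq0.
Qed.

(** The determinant of the n by n matrix sigma produces n weight factors and det(J)^2; together with
    the one in the statement they multiply to 1. *)
Lemma tau_law i j x : overlap i j x ->
  wf i j x * tau sigma j (trans i j x) = tau sigma i x.
Proof.
move=> ijx; rewrite !tauE (bivec_law sigma ijx) detZ !det_mulmx det_tr.
rewrite -/(wf i j x); pose e := epsilon_norm (R := R) (n := n) * \det (sigma i x).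
transitivity (wf i j x ^+ n.+1 * \det (jac i j x) ^+ 2 * e).
  by rewrite exprS /e; ring.
by rewrite weight_factorX // mul1r.
Qed.

Lemma inverse_metric_law i j x : overlap i j x ->
  inverse_metric sigma j (trans i j x) =
  (jac i j x)^T *m inverse_metric sigma i x *m jac i j x.
Proof.
move=> ijx; rewrite /inverse_metric (bivec_law sigma ijx) scalerA -/(wf i j x) mulrC tau_law //.
by rewrite -scalemxAr -scalemxAl.
Qed.

Lemma metric_law i j x : overlap i j x ->
  metric_of sigma i x =
  jac i j x *m metric_of sigma j (trans i j x) *m (jac i j x)^T.
Proof.
move=> ijx; have uJ := jac_unitmx omega_volume ijx.
have uJT : (jac i j x)^T \in unitmx by rewrite unitmx_tr.
have uhi := inverse_metric_unitmx sigma_nondegenerate (overlap_img ijx).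
have uhj := inverse_metric_unitmx sigma_nondegenerate (trans_img ijx).
rewrite /metric_of -/(inverse_metric sigma i x) -/(inverse_metric sigma j _).
apply: (can_inj (mulKmx uhi)); rewrite mulmxV // -[LHS](mulmx1C (A := (jac i j x)^T)
  (B := inverse_metric sigma i x *m jac i j x *m invmx (inverse_metric sigma j (trans i j x)))).
  by rewrite !mulmxA.
by rewrite !mulmxA -inverse_metric_law // mulmxV.
Qed.

(** The weights 2(n+1) and -2(n+1) cancel. Integral powers avoid roots and absolute values of
    quantities of unknown sign. *)
Definition scale i x : R := tau sigma i x ^+ n.+1 * omega i x ^+ 2.

Lemma scale_law i j x : overlap i j x -> scale i x = scale j (trans i j x).
Proof.
move=> ijx; rewrite /scale -(tau_law ijx) (volume_law omega_volume ijx) !exprMn.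
rewrite -[LHS]mulr1; transitivity (wf i j x ^+ n.+1 * \det (jac i j x) ^+ 2 *
  (tau sigma j (trans i j x) ^+ n.+1 * omega j (trans i j x) ^+ 2)); first by ring.
by rewrite weight_factorX // mul1r.
Qed.

Lemma scale_smooth i : smooth_on (img i) (scale i).
Proof.
have oi := open_img i; apply: smoothM => //; apply: smoothX => //.
  exact: tau_smooth.
exact: volume_smooth.
Qed.

Lemma scale_neq0 i x : img i x -> scale i x != 0.
Proof.
move=> ix; rewrite mulf_neq0 // expf_neq0 //; first exact: tau_neq0.
exact: (volume_neq0 omega_volume).
Qed.

Lemma partial_scale i x a : img i x ->
  partial a (scale i) x = - 2 * n.+1%:R * scale i x * upsilon G sigma i x a 0.
Proof.
move=> ix; have d_tau := smooth_differentiable (tau_smooth sigma i) ix.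
have d_omega := smooth_differentiable (volume_smooth omega_volume i) ix.
have tau0 := tau_neq0 sigma_nondegenerate ix.
have omega0 := volume_neq0 omega_volume ix.
rewrite partialM; try exact: differentiable_pow.
rewrite !partialX //= (upsilon_log sigma_nondegenerate sigma_metricity omega_volume omega_parallel) //.
rewrite /scale (exprS (tau sigma i x) n) -natr1; have : n%:R + 1 != 0 :> R by rewrite natr1 pnatr_eq0.
by move: (tau sigma i x ^+ n) => T n1; field; rewrite n1 omega0.
Qed.

(** Upsilon is a multiple of the logarithmic differential of the chart independent function
    [scale]. *)
Lemma upsilon_law i j x a : overlap i j x ->
  upsilon G sigma i x a 0 = \sum_b jac i j x a b * upsilon G sigma j (trans i j x) b 0.
Proof.
move=> ijx; have ix := overlap_img ijx; have jx := trans_img ijx.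
have c0 : - 2 * n.+1%:R * scale i x != 0.
  by rewrite mulf_neq0 ?scale_neq0 // mulf_neq0 ?pnatr_eq0 // oppr_eq0 pnatr_eq0.
apply: (mulfI c0); rewrite -partial_scale //.
rewrite (partial_eq a (@open_overlap i j) ijx (fun y => @scale_law i j y)).
rewrite partial_trans //; last exact: smooth_differentiable (@scale_smooth j) jx.
rewrite big_distrr; apply: eq_bigr => b _ /=.
by rewrite partial_scale // -scale_law //; ring.
Qed.

(** The Christoffel law is affine, and [ghat] differs from G by a tensor built from the 1-form
    Upsilon. *)
Lemma ghat_law : christoffel_law (ghat G sigma).
Proof.
move=> i j x ijx k a b; rewrite -[RHS](addrK 0) addr0.
have := gamma_law G ijx k a b => law.
transitivity (\sum_c \sum_d jac i j x a c * jac i j x b d * gamma G j (trans i j x) k c d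
  + jac i j x b k * upsilon G sigma i x a 0 + jac i j x a k * upsilon G sigma i x b 0).
  rewrite (upsilon_law a ijx) (upsilon_law b ijx) !big_distrr.
  have -> : \sum_c jac i j x a k * (jac i j x b c * upsilon G sigma j (trans i j x) c 0) =
      \sum_c kron R k c * \sum_d (jac i j x a c * (jac i j x b d * upsilon G sigma j (trans i j x) d 0)).
    by rewrite kron_sum.
  rewrite -!big_split; apply: eq_bigr => c _ /=.
  rewrite -(kron_sum k (fun d => jac i j x b d * (jac i j x a c * upsilon G sigma j (trans i j x) c 0))).
  rewrite big_distrr -!big_split; apply: eq_bigr => d _ /=.
  by rewrite /ghat; ring.
rewrite law subr0.
have -> : \sum_c jac i j x c k * ghat G sigma i x c a b =
    \sum_c jac i j x c k * gamma G i x c a b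
    + jac i j x b k * upsilon G sigma i x a 0 + jac i j x a k * upsilon G sigma i x b 0.
  rewrite -(kron_sum b (fun c => jac i j x c k * upsilon G sigma i x a 0)).
  rewrite -(kron_sum a (fun c => jac i j x c k * upsilon G sigma i x b 0)).
  rewrite -!big_split; apply: eq_bigr => c _ /=.
  by rewrite /ghat (kronC R c a) (kronC R c b); ring.
ring.
Qed.

(** In both charts the Ricci tensor of [ghat] is (n-1) lambda g. Ricci and g transform alike, and g
    is not zero, so the factors agree. *)
Lemma einstein_factor_law i j x : overlap i j x ->
  (forall a b, tractor_conn2 G (L G sigma) i x a b = 0) ->
  (forall a b, tractor_conn2 G (L G sigma) j (trans i j x) a b = 0) ->
  einstein_factor G sigma i x = einstein_factor G sigma j (trans i j x).
Proof.
move=> ijx hi hj; have ix := overlap_img ijx; have jx := trans_img ijx.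
have s_ghat := ghat_smooth (fun i c a b => gamma_smooth G i c a b) sigma_nondegenerate.
have ricE i' y a b : img i' y -> (forall a b, tractor_conn2 G (L G sigma) i' y a b = 0) ->
    ricci (ghat G sigma) i' y a b =
    (n%:R - 1) * einstein_factor G sigma i' y * metric_of sigma i' y a b.
  move=> iy h; rewrite (ricci_ghat n_ge2 (fun i c a b => gamma_smooth G i c a b)
    G_torsion_free sigma_nondegenerate sigma_metricity omega_volume omega_parallel) //.
  by rewrite (conn2_eq0 (fun i c a b => gamma_smooth G i c a b) sigma_nondegenerate sigma_metricity iy h) mulrA.
have gx : (n%:R - 1) * einstein_factor G sigma i x *: metric_of sigma i x =
    (n%:R - 1) * einstein_factor G sigma j (trans i j x) *: metric_of sigma i x.
  apply/matrixP => a b; rewrite [LHS]mxE -ricE //.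
  rewrite (ricci_law s_ghat ghat_law a b ijx (jac_unitmx omega_volume ijx)).
  rewrite (metric_law ijx) [RHS]mxE [X in _ * X]mxE big_distrr exchange_big.
  apply: eq_bigr => d _ /=; rewrite [X in _ * (X * _)]mxE big_distrl big_distrr.
  by apply: eq_bigr => c _ /=; rewrite ricE // [_^T _ _]mxE; ring.
have n1 : n%:R - 1 != 0 :> R.
  by rewrite subr_eq0 pnatr_eq1; case: (n) n_ge2 => [|[]].
apply: (mulfI n1); apply/eqP; rewrite -subr_eq0.
(* Either the difference of the factors is zero or g is; the latter contradicts invertibility, as n
   > 0 provides a diagonal entry. *)
move/eqP: gx; rewrite -subr_eq0 -scalerBl scaler_eq0 => /orP[//|/eqP g0].
have n0 : (0 < n)%N by exact: leq_trans n_ge2.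
have := mulmxV (metric_unitmx sigma_nondegenerate ix).
rewrite g0 mul0mx => /matrixP/(_ (Ordinal n0) (Ordinal n0)); rewrite !mxE eqxx.
by move=> /esym/eqP; rewrite oner_eq0.
Qed.

End Solution.
End Overlap.

(** * Conclusion *)

Section Surface.
Context {R : realType}.
Variables (C : 'I_2 -> 'I_2 -> 'I_2 -> 'I_2 -> R) (g : 'M[R]_2) (K : R).
Hypothesis C_anti : forall a b c d, C a b c d = - C b a c d.
Hypothesis g_sym : forall a b, g a b = g b a.
Hypothesis g_unitmx : g \in unitmx.

Lemma sum_ord2 (F : 'I_2 -> R) : \sum_a F a = F 0 + F 1.
Proof. by rewrite !big_ord_recl big_ord0 addr0; congr (_ + F _); apply: val_inj. Qed.

Lemma bilinear2 (u v : 'rV[R]_2) : (u *m g *m v^T) 0 0 =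
  u 0 0 * g 0 0 * v 0 0 + u 0 0 * g 0 1 * v 0 1
  + u 0 1 * g 0 1 * v 0 0 + u 0 1 * g 1 1 * v 0 1.
Proof. by rewrite mxE sum_ord2 !mxE !sum_ord2 (g_sym 1 0); ring. Qed.

(** Antisymmetry in the first two indices factors out the area of (u, v). *)
Lemma sectional2 (u v : 'rV[R]_2) :
  \sum_a \sum_b \sum_c \sum_d
    (\sum_e g c e * C a b e d) * u 0 a * v 0 b * u 0 c * v 0 d =
  (u 0 0 * v 0 1 - u 0 1 * v 0 0) *
  (\sum_c \sum_d (g c 0 * C 0 1 0 d + g c 1 * C 0 1 1 d) * u 0 c * v 0 d).
Proof.
have C0 a c d : C a a c d = 0 by have := C_anti a a c d; lra.
by rewrite !sum_ord2 !C0 !(C_anti 1 0); ring.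
Qed.

(** Up to sign the Ricci entries are the entries [C 0 1 c d]. Constant curvature K says that, with
    the upper index lowered, these form K det g times the area form. *)
Lemma constant_sectional_ricci2 :
  (forall u v : 'rV[R]_2, \sum_a \sum_b \sum_c \sum_d
      (\sum_e g c e * C a b e d) * u 0 a * v 0 b * u 0 c * v 0 d =
    K * ((u *m g *m u^T) 0 0 * (v *m g *m v^T) 0 0 - (u *m g *m v^T) 0 0 ^+ 2)) <->
  (forall a b, \sum_c C c a c b = K * g a b).
Proof.
have C0 a c d : C a a c d = 0 by have := C_anti a a c d; lra.
have ric b : (\sum_c C c 0 c b = - C 0 1 1 b) * (\sum_c C c 1 c b = C 0 1 0 b).
  by split; rewrite sum_ord2 !C0 ?(C_anti 1 0); ring.
split=> [h|h u v]; last first.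
  have X d : C 0 1 0 d = K * g 1 d by rewrite -h (ric d).2.
  have Y d : C 0 1 1 d = - (K * g 0 d) by rewrite -h (ric d).1 opprK.
  by rewrite sectional2 !bilinear2 !sum_ord2 !X !Y !(g_sym 1 0); ring.
have det_neq0 : g 0 0 * g 1 1 - g 0 1 * g 0 1 != 0.
  move: g_unitmx; rewrite unitmxE unitfE (expand_det_row _ 0) sum_ord2 /cofactor.
  rewrite !det_mx11 !mxE /= expr0 expr1.
  have -> : lift (0 : 'I_2) (0 : 'I_1) = 1 by exact: val_inj.
  have -> : lift (1 : 'I_2) (0 : 'I_1) = 0 by exact: val_inj.
  by rewrite (g_sym 1 0); apply: contraNN => /eqP e0; apply/eqP; rewrite -[RHS]e0 /=; ring.
pose w (p q : R) : 'rV[R]_2 := \row_j if j == 0 then p else q.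
have w0 p q : w p q 0 0 = p by rewrite mxE.
have w1 p q : w p q 0 1 = q by rewrite mxE.
have e p q r s := h (w p q) (w r s).
(* Pairs (u, v) of area 1 or -1: their equations determine the four entries g_c0 [C 0 1 0 d] + g_c1
   [C 0 1 1 d]. *)
have e1 := e 1 0 0 1; have e2 := e 1 0 1 1; have e3 := e 0 1 1 0; have e4 := e 1 1 0 1.
move: e1 e2 e3 e4; rewrite !sectional2 !bilinear2 !sum_ord2 !w0 !w1 !(g_sym 1 0) => e1 e2 e3 e4.
pose D := g 0 0 * g 1 1 - g 0 1 * g 0 1.
have m01 : g 0 0 * C 0 1 0 1 + g 0 1 * C 0 1 1 1 = K * D by rewrite /D; lra.
have m00 : g 0 0 * C 0 1 0 0 + g 0 1 * C 0 1 1 0 = 0 by rewrite /D in m01; lra.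
have m10 : g 0 1 * C 0 1 0 0 + g 1 1 * C 0 1 1 0 = - (K * D) by rewrite /D; lra.
have m11 : g 0 1 * C 0 1 0 1 + g 1 1 * C 0 1 1 1 = 0 by rewrite /D in m01; lra.
have I2 (a : 'I_2) : a = 0 \/ a = 1.
  by case: a => [[|[|//]] ?]; [left|right]; exact: val_inj.
(* After multiplication by det g, Cramer's rule recovers the entries of [C] from the lowered
   ones. *)
move=> a b; apply: (mulfI det_neq0).
case: (I2 a) => ->; case: (I2 b) => ->; rewrite ?(ric _).1 ?(ric _).2 ?(g_sym 1 0).
- transitivity (- (g 0 0 * (g 0 1 * C 0 1 0 0 + g 1 1 * C 0 1 1 0)
      - g 0 1 * (g 0 0 * C 0 1 0 0 + g 0 1 * C 0 1 1 0))); first by ring.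
  by rewrite m10 m00 /D; ring.
- transitivity (- (g 0 0 * (g 0 1 * C 0 1 0 1 + g 1 1 * C 0 1 1 1)
      - g 0 1 * (g 0 0 * C 0 1 0 1 + g 0 1 * C 0 1 1 1))); first by ring.
  by rewrite m11 m01 /D; ring.
- transitivity (g 1 1 * (g 0 0 * C 0 1 0 0 + g 0 1 * C 0 1 1 0)
      - g 0 1 * (g 0 1 * C 0 1 0 0 + g 1 1 * C 0 1 1 0)); first by ring.
  by rewrite m10 m00 /D; ring.
- transitivity (g 1 1 * (g 0 0 * C 0 1 0 1 + g 0 1 * C 0 1 1 1)
      - g 0 1 * (g 0 1 * C 0 1 0 1 + g 1 1 * C 0 1 1 1)); first by ring.
  by rewrite m11 m01 /D; ring.
Qed.

End Surface.

(** * From vanishing derivatives in the charts to a constant on M *)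

Section Globalise.
Context {R : realType} {n : nat} {M : topologicalType} {A : smooth_atlas R n M}.
Hypothesis M_connected : connected [set: M].

Lemma locally_constant_constant (F : M -> R) :
  (forall q, \forall r \near q, F r = F q) -> forall q r, F q = F r.
Proof.
move=> F_loc q r; pose B := [set s | F s = F r].
have oB : open B by rewrite openE => s Bs; apply: filterS (F_loc s) => s' e; rewrite /B /= e.
have cB : closed B.
  by rewrite -openC openE => s Bs; apply: filterS (F_loc s) => s' e; rewrite /B /= e.
suff : B = setT by move=> BT; have : B q by rewrite BT.
apply: M_connected; first by exists r.
- by exists B; rewrite ?setTI.
- by exists B; rewrite ?setTI.
Qed.

(** The family descends to a function on M, evaluated in a chosen chart at each point; the overlap
    law makes the choice harmless. *)
Lemma chart_locally_constant (f : chart A -> 'rV[R]_n -> R) :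
  (forall i, smooth_on (img i) (f i)) ->
  (forall i x, img i x -> forall a, partial a (f i) x = 0) ->
  (forall i j x, overlap i j x -> f i x = f j (trans i j x)) ->
  exists K, forall i x, img i x -> f i x = K.
Proof.
move=> sf df f_law; pose ch q := sval (cid (dom_cover A q)).
have chP q : dom (ch q) q by rewrite /ch; case: cid.
pose F q := f (ch q) (Defs.coord (ch q) q).
have FE i q : dom i q -> F q = f i (Defs.coord i q).
  move=> iq; have ijx : overlap (ch q) i (Defs.coord (ch q) q).
    by split; [exists q|rewrite coordK].
  by rewrite /F (f_law _ _ _ ijx) /trans coordK.
have F_loc q : \forall r \near q, F r = F q.
  have iq := chP q; have ix : img (ch q) (Defs.coord (ch q) q) by exists q.
  have h := partial0_locally_cst (open_img (ch q)) ix
    (fun y iy => smooth_differentiable (sf (ch q)) iy) (df (ch q)).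
  have h1 : \forall r \near q, f (ch q) (Defs.coord (ch q) r) = F q.
    exact: Defs.coord_continuous iq _ h.
  have h2 : \forall r \near q, dom (ch q) r.
    exact: open_nbhs_nbhs (conj (dom_open (ch q)) iq).
  by apply: filterS2 h1 h2 => r fr /FE ->.
(* Connectedness as stated allows M to be empty, in which case any constant will do. *)
have [[q0]|noM] := pselect (exists q : M, True).
  exists (F q0) => i x [q iq <-]; rewrite -FE //; exact: locally_constant_constant.
by exists 0 => i x [q _ _]; case: noM; exists q.
Qed.

End Globalise.

Section Reflexivity.
Context {R : realType}.

Lemma smooth_id (I : set R) : open I -> smooth_on I (fun t : R => t).
Proof.
move=> oI [|k]; first by move=> t _; exact: cvg_id.
split=> [t _|v]; first by apply/derivable1_diffP; exact: derivable_id.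
by apply: (Ck_on_eq oI _ (Ck_on_cst oI k v)) => t _; rewrite derive_id.
Qed.

(** Needed to place the connection that generates [p] in [p] itself. *)
Lemma geodesics_included_refl n (M : topologicalType) (A : smooth_atlas R n M)
  (G : christoffels A) : geodesics_included G G.
Proof.
move=> I c oI gc; exists I, (fun t => t); split=> //; split=> //.
- by apply: smooth_id; case: oI.
- by move=> t _; rewrite derive1_id oner_neq0.
- exact: image_id.
Qed.

End Reflexivity.

Lemma curvature_anti (R : realType) n (M : topologicalType) (A : smooth_atlas R n M)
  (H : christoffels A) i x a b c d : curvature H i x a b c d = - curvature H i x b a c d.
Proof.
by rewrite /curvature opprD opprB -sumrN; congr (_ + _); apply: eq_bigr => e _; rewrite opprB.
Qed.

Lemma ricci_levi_civita (R : realType) n (M : topologicalType) (A : smooth_atlas R n M)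
  (g : chart A -> 'rV[R]_n -> 'M[R]_n) (H : christoffels A) i x a b :
  (forall y, img i y -> forall c a b, levi_civita g i y c a b = H i y c a b) -> img i x ->
  ricci (levi_civita g) i x a b = ricci H i x a b.
Proof.
move=> gH ix; apply: eq_bigr => c _; rewrite /curvature.
have pE e k l m : partial e (fun y => levi_civita g i y k l m) x =
    partial e (fun y => H i y k l m) x.
  by apply: (partial_eq e (open_img i) ix) => y iy; rewrite gH.
by rewrite !pE; congr (_ + _); apply: eq_bigr => e _; rewrite !gH.
Qed.

(** Brings the case n = 2 to the same form Ric = K g as the others. *)
Lemma einsteinE (R : realType) n (M : topologicalType) (A : smooth_atlas R n M)
  (g : chart A -> 'rV[R]_n -> 'M[R]_n) :
  (forall i x, img i x -> forall a b, g i x a b = g i x b a) ->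
  (forall i x, img i x -> g i x \in unitmx) ->
  einstein g <-> exists K : R, forall i x, img i x -> forall a b,
    ricci (levi_civita g) i x a b = K * g i x a b.
Proof.
rewrite /einstein; case: eqP => // n2; subst n => g_sym g_unit.
have e i x K (ix : img i x) := constant_sectional_ricci2 K
  (@curvature_anti R 2 M A (levi_civita g) i x) (g_sym i x ix) (g_unit i x ix).
by split=> -[K h]; exists K => i x ix; apply/e => //; exact: h.
Qed.

(** * The two implications for a single connection *)

Section Main.
Context {R : realType} {n : nat} {M : topologicalType} {A : smooth_atlas R n M}.
Variables (G : affine_connection A) (sigma : S2TM A (-2)).
Hypothesis n_ge2 : (2 <= n)%N.
Hypothesis G_special : special_torsion_free G.
Hypothesis sigma_nondegenerate : nondegenerate_section sigma.
Hypothesis sigma_metricity : forall i x, img i x -> forall a b c,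
  metricity_op G sigma i x a b c = 0.
Let sG := fun i c a b => gamma_smooth G i c a b.
Let G_torsion_free := G_special.1.
Let n1 : n%:R - 1 != 0 :> R.
Proof. by rewrite subr_eq0 pnatr_eq1; case: (n) n_ge2 => [|[]]. Qed.

Lemma ricci_metric i x a b : img i x ->
  ricci (levi_civita (metric_of sigma)) i x a b = (n%:R - 1) * schouten_hat G sigma i x a b.
Proof.
move=> ix; have [omega vol par] := G_special.2.
rewrite (@ricci_levi_civita _ _ _ _ _ (ghat G sigma)) //; last first.
  by move=> y iy c a' b'; exact: levi_civita_ghat.
exact: (ricci_ghat n_ge2 sG G_torsion_free sigma_nondegenerate sigma_metricity vol par).
Qed.

Lemma parallel_einstein : connected [set: M] -> parallel G (L G sigma) ->
  exists K : R, forall i x, img i x -> forall a b,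
    ricci (levi_civita (metric_of sigma)) i x a b = K * metric_of sigma i x a b.
Proof.
move=> M_connected par; have [omega vol omega_par] := G_special.2.
have conn2 i x (ix : img i x) := let: And3 _ h _ := par i x ix in h.
have [] := @chart_locally_constant R n M A M_connected (einstein_factor G sigma).
- exact: einstein_factor_smooth.
- move=> i x ix a; rewrite partial_einstein_factor //; last exact: conn2.
  by have [_ _ ->] := par i x ix; rewrite mulr0.
- move=> i j x ijx; apply: (einstein_factor_law n_ge2 G_torsion_free sigma_nondegenerate
    sigma_metricity vol omega_par ijx); apply: conn2.
    exact: overlap_img ijx.
  exact: trans_img.
(* The factor n-1 passes from the Schouten to the Ricci tensor. *)
move=> K hK; exists ((n%:R - 1) * K) => i x ix a b.
rewrite ricci_metric // (conn2_eq0 sG sigma_nondegenerate sigma_metricity ix (conn2 i x ix)).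
by rewrite hK // mulrA.
Qed.

Lemma einstein_parallel (K : R) :
  (forall i x, img i x -> forall a b,
    ricci (levi_civita (metric_of sigma)) i x a b = K * metric_of sigma i x a b) ->
  parallel G (L G sigma).
Proof.
move=> hK.
have hat i x (ix : img i x) a b :
    schouten_hat G sigma i x a b = K / (n%:R - 1) * metric_of sigma i x a b.
  by apply: (mulfI n1); rewrite -ricci_metric // hK //; field.
have E i x (ix : img i x) :=
  schouten_hat_proportional n_ge2 sG sigma_nondegenerate sigma_metricity ix (hat i x ix).
move=> i x ix; split=> [a b c|a b|a].
- by rewrite /tractor_conn1 metricity_nabla2 // -addrA addNr.
- exact: (E i x ix).1.
(* Multiplied by tau, the third component is d lambda, and lambda is identically K/(n-1) on the
   chart. *)
apply: (mulfI (tau_neq0 sigma_nondegenerate ix)); rewrite mulr0.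
rewrite -(partial_einstein_factor sG sigma_nondegenerate sigma_metricity a ix (E i x ix).1).
rewrite (partial_eq a (open_img i) ix (g := fun _ => K / (n%:R - 1))) ?partial_cst //.
by move=> y iy; exact: (E i y iy).2.
Qed.

End Main.

Theorem theorem3p3 (R : realType) (n : nat) (n_ge2 : (2 <= n)%N)
    (M : topologicalType) (M_hausdorff : hausdorff_space M)
    (M_second_countable : @second_countable M)
    (M_connected : connected [set: M])
    (A : smooth_atlas R n M) (M_orientable : orientable A)
    (p : set (affine_connection A)) (p_projective : projective_structure p)
    (sigma : S2TM A (-2)) (sigma_nondegenerate : nondegenerate_section sigma)
    (sigma_metricity : metricity_solution p sigma) :
  normal_solution p sigma <-> einstein (metric_of sigma).
Proof.
rewrite (einsteinE (fun i x ix a b => metric_of_sym sigma a b ix)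
  (fun i x ix => metric_unitmx sigma_nondegenerate ix)).
have [G0 G0_special pE] := p_projective.
split=> [normal|[K hK] G pG].
  (* Normality is needed for one connection only, whereas the converse has to reach every member of
     [p]. *)
  have pG0 : p G0.
    by rewrite pE; split=> //; split; exact: geodesics_included_refl.
  apply: (parallel_einstein n_ge2 G0_special sigma_nondegenerate (sigma_metricity _ pG0)) => //.
  exact: normal.
have G_special : special_torsion_free G by move: pG; rewrite pE => -[].
exact: (einstein_parallel n_ge2 G_special sigma_nondegenerate (sigma_metricity _ pG) hK).
Qed.
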